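(* Fix $\alpha > 0$. The length-scaled Robin spectral ratio $$\frac{\lambda_2(\mathcal{R};\alpha/L)}{|\lambda_1(\mathcal{R};\alpha/L)|},$$ where $L$ is the perimeter of $\mathcal{R}$, is maximal for the square and only the square, among rectangles $\mathcal{R} \subset \mathbb{R}^2$.
   Context: Rectangles are (up to rotation) products of two bounded nonempty open intervals. For a bounded Lipschitz domain $\Omega \subset \mathbb{R}^2$ and $\beta \in \mathbb{R}$, the Robin eigenvalues $\lambda_1(\Omega;\beta) < \lambda_2(\Omega;\beta) \leq \dots$ are the eigenvalues, counted with multiplicity, of $-\Delta u = \lambda u$ in $\Omega$ with $\partial u/\partial \nu + \beta u = 0$ on $\partial \Omega$ ($\nu$ the outward unit normal). Equivalently $$\lambda_k(\Omega;\beta) = \min_{U_k} \max_{u \in U_k \setminus \{0\}} \frac{\int_\Omega |\nabla u|^2\,dx + \beta \int_{\partial\Omega} u^2\,dS}{\int_\Omega u^2\,dx},$$ where $U_k$ ranges over $k$-dimensional subspaces of $H^1(\Omega)$. *)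

(* Defs.v *)
From HB Require Import structures.
From mathcomp Require Import all_boot all_order all_algebra.
From mathcomp Require Import all_classical all_reals all_analysis.
Set Implicit Arguments.
Unset Strict Implicit.
Unset Printing Implicit Defensive.
Import Order.TTheory GRing.Theory Num.Theory.
Import numFieldNormedType.Exports.
Local Open Scope classical_set_scope.
Local Open Scope ring_scope.

(** * Rectangles in the plane *)

Definition rot (R : realType) (t : R) (p : R * R) : R * R :=
  (cos t * p.1 - sin t * p.2, sin t * p.1 + cos t * p.2).

(** [Rectangle th a b c d _ _] stands for the image of the product
    [`]a, b[ x `]c, d[] under the rotation of angle [th] about the origin. The
    position of the product is arbitrary, so every open rectangle of the plane is
    of this form (for several angles [th]). *)
Record rectangle (R : realType) := Rectangle {
  rangle : R;
  rleft : R;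
  rright : R;
  rbottom : R;
  rtop : R;
  rlr : rleft < rright;
  rbt : rbottom < rtop
}.

Section Rectangles.
Context {R : realType}.
Implicit Type Q : rectangle R.

Definition rwidth Q : R := rright Q - rleft Q.
Definition rheight Q : R := rtop Q - rbottom Q.

Definition is_square Q : Prop := rwidth Q = rheight Q.

Definition perimeter Q : R := 2 * (rwidth Q + rheight Q).

Definition domain Q : set (R * R) :=
  rot (rangle Q) @` (`]rleft Q, rright Q[ `*` `]rbottom Q, rtop Q[).

(** The boundary is parametrized by arc length, one side at a time: [h] tells
    whether the side comes from a horizontal side of the unrotated rectangle, and
    [e] which of the two such sides it is. *)
Definition side_range Q (h : bool) : set R :=
  if h then `[rleft Q, rright Q]%classic else `[rbottom Q, rtop Q]%classic.

Definition side Q (h e : bool) (s : R) : R * R :=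
  rot (rangle Q) (if h then (s, if e then rtop Q else rbottom Q)
                       else (if e then rright Q else rleft Q, s)).

End Rectangles.

(** * Square-integrable functions *)

Section L2.
Context {R : realType} {d : measure_display} {T : measurableType d}.
Variable mu : {measure set T -> \bar R}.
Implicit Types (D : set T) (f : T -> R).

Definition L2 D f : Prop :=
  measurable_fun D f /\ (\int[mu]_(x in D) ((f x ^+ 2)%:E) < +oo)%E.

Definition L2_cvg D (v : nat -> T -> R) f : Prop :=
  (fun n => \int[mu]_(x in D) (((v n x - f x) ^+ 2)%:E))%E @ \oo --> 0%E.

End L2.

Notation leb1 R := (@lebesgue_measure R).
Notation leb2 R := (@lebesgue_measure R \x @lebesgue_measure R)%E.

(** * The Sobolev space [H^1] *)

Section Sobolev.
Context {R : realType}.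
Implicit Types (Q : rectangle R) (f g : R * R -> R).

(** [i = false] is the first coordinate, [i = true] the second one. *)
Definition dir (i : bool) : R * R := if i then (0, 1) else (1, 0).

Definition partial (i : bool) f (x : R * R) : R := 'D_(dir i) f x.

Definition C1 f : Prop :=
  (forall x, differentiable f x) /\
  (forall i, continuous (partial i f)).

Definition C1c (D : set (R * R)) f : Prop :=
  C1 f /\ exists K, [/\ compact K, K `<=` D & forall x, ~ K x -> f x = 0].

Definition weak_partial (D : set (R * R)) (i : bool) f g : Prop :=
  forall phi, C1c D phi ->
    \int[leb2 R]_(x in D) (f x * partial i phi x) =
    - \int[leb2 R]_(x in D) (g x * phi x).

(** A function together with (representatives of) its weak gradient and its
    boundary trace, both of which it determines almost everywhere. Only the values
    of [trc] on the boundary matter. *)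
Record h1data := H1Data {
  fn : R * R -> R;
  grad : bool -> R * R -> R;
  trc : R * R -> R
}.

(** The trace operator is the continuous extension, from the H^1 norm on the
    domain to the L^2 norm on the boundary, of the restriction of C^1 functions
    to the boundary. *)
Definition has_trace Q (w : h1data) : Prop :=
  exists v : nat -> R * R -> R,
    [/\ forall n, C1 (v n),
        L2_cvg (leb2 R) (domain Q) v (fn w),
        forall i, L2_cvg (leb2 R) (domain Q) (fun n => partial i (v n)) (grad w i)
      & forall h e, L2_cvg (leb1 R) (side_range Q h)
          (fun n => v n \o side Q h e) (trc w \o side Q h e)].

(** By the trace theorem and the density of C^1 functions in H^1 (the domain is
    bounded and Lipschitz), [fn w] ranges over the whole of H^1 when [w] ranges
    over [H1 Q]. *)
Definition H1 Q : set h1data := [set w |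
  [/\ L2 (leb2 R) (domain Q) (fn w),
      forall i, L2 (leb2 R) (domain Q) (grad w i)
             /\ weak_partial (domain Q) i (fn w) (grad w i),
      forall h e, L2 (leb1 R) (side_range Q h) (trc w \o side Q h e)
    & has_trace Q w]].

Definition comb k (c : 'rV[R]_k) (u : 'I_k -> h1data) : h1data :=
  H1Data (fun x => \sum_(i < k) c 0 i * fn (u i) x)
         (fun j x => \sum_(i < k) c 0 i * grad (u i) j x)
         (fun x => \sum_(i < k) c 0 i * trc (u i) x).

(** [u] is a basis of a [k]-dimensional subspace of [H^1], whose elements are
    functions up to equality almost everywhere. *)
Definition H1_basis Q k (u : 'I_k -> h1data) : Prop :=
  (forall i, H1 Q (u i)) /\
  (forall c : 'rV[R]_k,
     {ae leb2 R, forall x, domain Q x -> fn (comb c u) x = 0} -> c = 0).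

End Sobolev.

(** * Robin eigenvalues *)

Section Robin.
Context {R : realType}.
Implicit Types (Q : rectangle R) (beta alpha : R).

Definition boundary_integral Q (f : R * R -> R) : R :=
  \sum_(h : bool) \sum_(e : bool)
    \int[leb1 R]_(s in side_range Q h) f (side Q h e s).

Definition rayleigh Q beta (w : h1data) : R :=
  (\int[leb2 R]_(x in domain Q) (grad w false x ^+ 2 + grad w true x ^+ 2)
   + beta * boundary_integral Q (fun x => trc w x ^+ 2))
  / \int[leb2 R]_(x in domain Q) (fn w x ^+ 2).

Definition max_rayleigh Q beta k (u : 'I_k -> h1data) : \bar R :=
  ereal_sup [set (rayleigh Q beta (comb c u))%:E | c in [set c : 'rV[R]_k | c != 0]].

(** The eigenvalues are numbered from [k = 1]. The minimum over subspaces and the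
    maximum over each of them are attained, so that they agree with the infimum
    and the supremum in the extended reals; the resulting value is finite. *)
Definition robin_eigenvalue Q beta k : R :=
  fine (ereal_inf [set max_rayleigh Q beta u | u in @H1_basis R Q k]).

Definition spectral_ratio alpha Q : R :=
  robin_eigenvalue Q (alpha / perimeter Q) 2
  / `|robin_eigenvalue Q (alpha / perimeter Q) 1|.

End Robin.

(* Main.v *)
Require Import Defs.
From HB Require Import structures.
From mathcomp Require Import all_boot all_order all_algebra.
From mathcomp Require Import all_classical all_reals all_analysis.
From mathcomp Require Import measurable_realfun.
From mathcomp Require Import ring lra.
Import Order.TTheory GRing.Theory Num.Theory.
Import numFieldNormedType.Exports.
Set Implicit Arguments.
Unset Strict Implicit.
Unset Printing Implicit Defensive.
Local Open Scope classical_set_scope.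
Local Open Scope ring_scope.

(** Why the theorem holds. In the coordinates of its sides, the Robin problem of a rectangle
    separates: for [beta > 0], its eigenvalues are the sums of an eigenvalue of each side.
    On a segment of half-length [l], the first two Robin modes are [cos (k * x)] and
    [sin (k * x)] around the midpoint, and the boundary conditions say that
    [k * l + atan (k / beta)] is [pi / 2] for the former and [pi] for the latter. Put
    [b = beta * l], and let [p] and [q] be the solutions of [p * b + atan p = pi / 2] and
    of [q * b + atan q = pi]; then the first two eigenvalues of the segment are
    [beta ^+ 2 * p ^+ 2] and [beta ^+ 2 * q ^+ 2]. With [b] and [b'] for the two sides, the
    spectral ratio of the rectangle is therefore
    [1 + min (q ^+ 2 - p ^+ 2) (q' ^+ 2 - p' ^+ 2) / (p ^+ 2 + p' ^+ 2)]
    ([spectral_ratioE]), and [beta = alpha / L] makes [b + b' = alpha / 4] a constant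
    ([half_sum]). Now the gap [q ^+ 2 - p ^+ 2] is a strictly decreasing function of [b]
    ([gap_decreasing]), so that the minimum is the gap of the longer side and is largest
    exactly when [b = b']; and [p ^+ 2] is a convex function of [b] ([freq1_convex]), so that
    the denominator is smallest when [b = b'].

    The eigenvalues are obtained from their variational definition ([robin_eigenvalueP]).
    Products of modes of the two sides give the upper bounds. For the lower bounds on C^1
    functions, one-dimensional inequalities are applied to the horizontal and vertical
    sections: Picone's inequality for the first eigenvalue ([robin1_lower]); for the second
    one, subtracting a multiple of the first mode makes a function vanish at the midpoint,
    and Picone's inequality with the second mode applies to both halves ([robin2_lower]).
    Their combination in the plane rests on the positivity of a product of two commuting
    projections ([bessel_tensor], [plane_energy_ge2]). The approximating sequences that
    define traces extend these bounds to [H1] ([approximable_limit]). The passage to the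
    coordinates of the sides uses the invariance of the plane Lebesgue measure under
    rotations, a consequence of the decomposition of rotations into shears ([leb2_rot]). *)

Local Notation rot := Defs.rot.

(** * Continuous functions and their integrals over segments and boxes *)

Section ContinuousFunctions.
Context {R : realType}.
Implicit Types a b c d k : R.

Lemma contD (T : topologicalType) (f g : T -> R) :
  continuous f -> continuous g -> continuous (fun x => f x + g x).
Proof. by move=> cf cg x; apply: continuousD; [exact: cf|exact: cg]. Qed.

Lemma contB (T : topologicalType) (f g : T -> R) :
  continuous f -> continuous g -> continuous (fun x => f x - g x).
Proof. by move=> cf cg x; apply: continuousB; [exact: cf|exact: cg]. Qed.

Lemma contN (T : topologicalType) (f : T -> R) :
  continuous f -> continuous (fun x => - f x).
Proof. by move=> cf x; apply: continuousN; exact: cf. Qed.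

Lemma contM (T : topologicalType) (f g : T -> R) :
  continuous f -> continuous g -> continuous (fun x => f x * g x).
Proof. by move=> cf cg x; apply: continuousM; [exact: cf|exact: cg]. Qed.

Lemma contX (T : topologicalType) (f : T -> R) n :
  continuous f -> continuous (fun x => f x ^+ n).
Proof.
move=> cf x; apply: (@continuous_comp _ _ _ f (fun y => y ^+ n)); first exact: cf.
exact: exprn_continuous.
Qed.

Lemma cont_cst (T : topologicalType) (c : R) : continuous (fun _ : T => c).
Proof. by move=> x; exact: cvg_cst. Qed.

Lemma cont_pair (S T U : topologicalType) (f : S -> T) (g : S -> U) :
  continuous f -> continuous g -> continuous (fun x => (f x, g x)).
Proof. by move=> cf cg x; apply: cvg_pair; [exact: cf|exact: cg]. Qed.

Lemma cont_comp (S T U : topologicalType) (g : T -> U) (f : S -> T) :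
  continuous g -> continuous f -> continuous (fun x => g (f x)).
Proof. by move=> cg cf x; apply: continuous_comp; [exact: cf|exact: cg]. Qed.

Lemma cont_secx (f : R * R -> R) y : continuous f -> continuous (fun x => f (x, y)).
Proof.
move=> cf; apply: (cont_comp cf); apply: cont_pair; first by move=> x; exact: cvg_id.
by move=> x; exact: cvg_cst.
Qed.

Lemma cont_secy (f : R * R -> R) x : continuous f -> continuous (fun y => f (x, y)).
Proof.
move=> cf; apply: (cont_comp cf); apply: cont_pair; last by move=> y; exact: cvg_id.
by move=> y; exact: cvg_cst.
Qed.

(** Squares with rational centers and radii [1 / (n + 1)] form a countable base of the
    plane. *)
Lemma open_measurable2 (U : set (R * R)) : open U -> measurable U.
Proof.
move=> oU.
pose box (q r : rat) (n : nat) : set (R * R) :=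
  ball (ratr q : R) n.+1%:R^-1 `*` ball (ratr r : R) n.+1%:R^-1.
have -> : U = \bigcup_q \bigcup_r \bigcup_(n in [set n | box q r n `<=` U]) box q r n.
  apply/seteqP; split; last by move=> x [q _ [r _ [n /= nU /nU]]].
  move=> [x y] Uxy; have := oU; rewrite openE => /(_ _ Uxy).
  rewrite /interior -nbhs_ballE => -[e /= e0 eU].
  have e2 : 0 < e / 2 by rewrite divr_gt0.
  have [n _ ne] := near_infty_natSinv_lt (PosNum e2).
  have {}ne := ne n (leqnn n).
  have d0 : 0 < n.+1%:R^-1 :> R by rewrite invr_gt0.
  have [q' [xq [q _ qE]]] : ball x (n.+1%:R^-1) `&` (@ratr R @` setT) !=set0.
    apply: dense_rat; last exact: ball_open.
    by exists x; exact: ballxx.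
  have [r' [yr [r _ rE]]] : ball y (n.+1%:R^-1) `&` (@ratr R @` setT) !=set0.
    apply: dense_rat; last exact: ball_open.
    by exists y; exact: ballxx.
  subst q' r'; exists q => //; exists r => //; exists n; last first.
    by split; exact: ball_sym.
  move=> [u v] [/= qu rv]; apply: eU; split => /=.
    apply: (@le_ball _ _ _ (n.+1%:R^-1 + n.+1%:R^-1)); last exact: ball_triangle xq qu.
    by rewrite [leRHS]splitr lerD// ltW.
  apply: (@le_ball _ _ _ (n.+1%:R^-1 + n.+1%:R^-1)); last exact: ball_triangle yr rv.
  by rewrite [leRHS]splitr lerD// ltW.
apply: bigcupT_measurable_rat => q; apply: bigcupT_measurable_rat => r.
apply: bigcup_measurable => n _; by apply: measurableX; apply: open_measurable; exact: ball_open.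
Qed.

Lemma continuous_measurable2 (f : R * R -> R) : continuous f -> measurable_fun setT f.
Proof.
move=> /continuousP cf; apply: (measurability _ (RGenOpens.measurableE R)).
move=> _ [_ [a [b ->] <-]]; rewrite setTI; apply: open_measurable2.
exact/cf/interval_open.
Qed.

Lemma cont_bounded_box (f : R * R -> R) (a b c d : R) : continuous f ->
  exists M, forall x y, a <= x <= b -> c <= y <= d -> `|f (x, y)| <= M.
Proof.
move=> cf.
have [ab|ba] := leP a b; last first.
  by exists 0 => x y /andP[/le_trans h /h]; rewrite leNgt ba.
have [cd|dc] := leP c d; last first.
  by exists 0 => x y _ /andP[/le_trans h /h]; rewrite leNgt dc.
have [|||p _ pM] := @compact_EVT_max _ _ (fun p => `|f p|) (`[a, b] `*` `[c, d]).
- by exists (a, c); split; rewrite /= in_itv /= lexx.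
- by apply: compact_setX; exact: segment_compact.
- apply: continuous_subspaceT; apply: (cont_comp _ cf); exact: norm_continuous.
- exists `|f p| => x y xab ycd; apply: pM; rewrite inE; split => /=;
  by rewrite in_itv.
Qed.

(** On the closed segment, both the fundamental theorem of calculus and the
    parametrization of the sides of a rectangle apply as they stand; the open boxes
    below only differ from products of such segments by null sets. *)
Definition segint (a b : R) (f : R -> R) : R :=
  \int[@lebesgue_measure R]_(x in `[a, b]) f x.

Lemma segintE a b (f : R -> R) :
  segint a b f = \int[@lebesgue_measure R]_(x in `[a, b]) f x.
Proof. by []. Qed.

Lemma cont_integrable a b (f : R -> R) : continuous f ->
  (@lebesgue_measure R).-integrable `[a, b] (EFin \o f).
Proof.
move=> cf; apply: continuous_compact_integrable; first exact: segment_compact.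
exact: continuous_subspaceT.
Qed.

Lemma eq_segint a b (f g : R -> R) : (forall x, a <= x <= b -> f x = g x) ->
  segint a b f = segint a b g.
Proof. by move=> fg; apply: eq_Rintegral => x; rewrite inE/= in_itv/= => /fg. Qed.

Lemma segintD a b (f g : R -> R) : continuous f -> continuous g ->
  segint a b (fun x => f x + g x) = segint a b f + segint a b g.
Proof. by move=> cf cg; apply: RintegralD => //; exact: cont_integrable. Qed.

Lemma segintB a b (f g : R -> R) : continuous f -> continuous g ->
  segint a b (fun x => f x - g x) = segint a b f - segint a b g.
Proof. by move=> cf cg; apply: RintegralB => //; exact: cont_integrable. Qed.

Lemma segintZ a b k (f : R -> R) : continuous f ->
  segint a b (fun x => k * f x) = k * segint a b f.
Proof. by move=> cf; apply: RintegralZl => //; exact: cont_integrable. Qed.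

Lemma segint_ge0 a b (f : R -> R) : (forall x, a <= x <= b -> 0 <= f x) ->
  0 <= segint a b f.
Proof. by move=> f0; apply: Rintegral_ge0 => x /=; rewrite in_itv/=; exact: f0. Qed.

Lemma le_segint a b (f g : R -> R) : continuous f -> continuous g ->
  (forall x, a <= x <= b -> f x <= g x) -> segint a b f <= segint a b g.
Proof.
move=> cf cg fg; apply: le_Rintegral; [exact: measurable_itv|exact: cont_integrable|exact: cont_integrable|].
by move=> x /=; rewrite in_itv/=; exact: fg.
Qed.

Lemma segint_FTC a b (F f : R -> R) : a < b -> continuous f ->
  (forall x : R, is_derive x 1 F (f x)) -> segint a b f = F b - F a.
Proof.
move=> ab cf dF; rewrite /segint /Rintegral (@continuous_FTC2 _ f F)//.
- exact: continuous_subspaceT.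
- have cF : continuous F.
    by move=> x; apply/differentiable_continuous/derivable1_diffP/ex_derive.
  split; [by move=> x _; exact: ex_derive|apply: cvg_at_right_filter; exact: cF|apply: cvg_at_left_filter; exact: cF].
- by move=> x _; rewrite derive1E derive_val.
Qed.

(** Dominated convergence: near [y], the integrands are bounded by the maximum of [|f|]
    on a compact box. *)
Lemma cont_segint1 a b (f : R * R -> R) : continuous f ->
  continuous (fun y => segint a b (fun x => f (x, y))).
Proof.
move=> cf y.
have [M fM] := cont_bounded_box a b (y - 1) (y + 1) cf.
apply: (@continuity_under_integral _ _ _ (@lebesgue_measure R)
  (fun y x => f (x, y)) `[a, b] _ (y - 1) (y + 1) _ _ (fun=> M)) => //.
- by move=> z _; apply: cont_integrable; exact: cont_secx.
- by apply: aeW => x _ z _; apply: cont_secy.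
- by apply: cont_integrable; exact: cont_cst.
- move=> z /=; rewrite in_itv/= => /andP[z1 z2]; apply: aeW => x /=.
  by rewrite in_itv/= => xab; apply: fM; rewrite ?(ltW z1) ?(ltW z2).
- by rewrite inE/= in_itv/= ltrDl ltrBlDr ltrDl ltr01.
Qed.

Lemma cont_swap (f : R * R -> R) : continuous f -> continuous (fun p => f (p.2, p.1)).
Proof.
by move=> cf; apply: (cont_comp cf); apply: cont_pair => p; [exact: cvg_snd|exact: cvg_fst].
Qed.

Lemma cont_segint2 a b (f : R * R -> R) : continuous f ->
  continuous (fun x => segint a b (fun y => f (x, y))).
Proof. by move=> cf; apply: (@cont_segint1 a b (fun p => f (p.2, p.1))); exact: cont_swap. Qed.

Definition box (a b c d : R) : set (R * R) := `]a, b[ `*` `]c, d[.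

Lemma measurable_box a b c d : measurable (box a b c d).
Proof. by apply: measurableX; exact: measurable_itv. Qed.

Lemma box_finite a b c d : (leb2 R (box a b c d) < +oo)%E.
Proof.
rewrite /box product_measure1E//= !lebesgue_measure_itv/=.
by case: ifPn => _; case: ifPn => _; rewrite -?EFinB ?mul0e ?mule0 ?ltry// -EFinM ltry.
Qed.

Lemma cont_integrable_box a b c d (f : R * R -> R) : continuous f ->
  (leb2 R).-integrable (box a b c d) (EFin \o f).
Proof.
move=> cf; apply: measurable_bounded_integrable.
- exact: measurable_box.
- exact: box_finite.
- by apply: measurable_funTS; exact: continuous_measurable2.
- have [M fM] := cont_bounded_box a b c d cf.
  exists M; split; first exact: num_real.
  move=> N /ltW MN [x y] [/=]; rewrite !in_itv/= => /andP[/ltW ax /ltW xb] /andP[/ltW cy /ltW yd].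
  by apply: le_trans MN; apply: fM; apply/andP.
Qed.

Lemma segint_oo a b (f : R -> R) : continuous f ->
  (\int[@lebesgue_measure R]_(x in `]a, b[) (f x)%:E = (segint a b f)%:E)%E.
Proof.
move=> cf; have if_ := cont_integrable a b cf.
have mf : measurable_fun setT (EFin \o f).
  by apply/measurable_EFinP; exact: continuous_measurable_fun.
rewrite integral_itv_bndo_bndc; last exact: measurable_funTS.
rewrite integral_itv_obnd_cbnd; last exact: measurable_funTS.
by rewrite /segint /Rintegral fineK// integrable_fin_num.
Qed.

Lemma restrict_box a b c d (f : R * R -> R) x y :
  (((EFin \o f) \_ (box a b c d)) (x, y) =
   ((fun x => ((fun y => (f (x, y))%:E) \_ `]c, d[) y) \_ `]a, b[) x)%E.
Proof.
rewrite /patch /box; case: ifPn => [|].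
  by rewrite in_setX/= => /andP[-> ->].
by rewrite in_setX/=; case: (x \in _) => //=; case: (y \in _).
Qed.

Lemma box_integral12 a b c d (f : R * R -> R) : continuous f ->
  \int[leb2 R]_(p in box a b c d) f p = segint a b (fun x => segint c d (fun y => f (x, y))).
Proof.
move=> cf; rewrite /Rintegral integral_mkcond.
have i2 : (leb2 R).-integrable setT ((EFin \o f) \_ (box a b c d)).
  apply: (@integrable_mkcond _ _ R (leb2 R) (box a b c d) (EFin \o f) (measurable_box a b c d)).1.
  exact: cont_integrable_box.
rewrite -(integral12_prod_meas1 i2) /fubini_F.
transitivity (fine (\int[@lebesgue_measure R]_(x in `]a, b[)
    (segint c d (fun y => f (x, y)))%:E)).
  congr fine; rewrite [RHS]integral_mkcond; apply: eq_integral => x _.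
  under eq_integral do rewrite restrict_box.
  rewrite /patch; case: ifPn => _; last by rewrite integral0.
  by rewrite -integral_mkcond segint_oo//; exact: cont_secy.
by rewrite segint_oo//; exact: cont_segint2.
Qed.

Lemma box_integral21 a b c d (f : R * R -> R) : continuous f ->
  \int[leb2 R]_(p in box a b c d) f p = segint c d (fun y => segint a b (fun x => f (x, y))).
Proof.
move=> cf; rewrite /Rintegral integral_mkcond.
have i2 : (leb2 R).-integrable setT ((EFin \o f) \_ (box a b c d)).
  apply: (@integrable_mkcond _ _ R (leb2 R) (box a b c d) (EFin \o f) (measurable_box a b c d)).1.
  exact: cont_integrable_box.
rewrite -(integral21_prod_meas1 i2) /fubini_G.
transitivity (fine (\int[@lebesgue_measure R]_(y in `]c, d[)
    (segint a b (fun x => f (x, y)))%:E)).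
  congr fine; rewrite [RHS]integral_mkcond; apply: eq_integral => y _.
  under eq_integral do rewrite restrict_box.
  have -> : (fun x => ((fun x => ((fun y => (f (x, y))%:E) \_ `]c, d[) y) \_ `]a, b[) x) =
     if y \in `]c, d[%classic then (fun x => (f (x, y))%:E) \_ `]a, b[ else cst 0%E.
    by apply/funext => x; rewrite /patch; case: (y \in _); case: (x \in _).
  rewrite [in RHS]/patch; case: ifPn => _; last by rewrite integral0.
  by rewrite -integral_mkcond segint_oo//; exact: cont_secx.
by rewrite segint_oo//; exact: cont_segint1.
Qed.

Lemma segint_swap a b c d (f : R * R -> R) : continuous f ->
  segint a b (fun x => segint c d (fun y => f (x, y))) =
  segint c d (fun y => segint a b (fun x => f (x, y))).
Proof. by move=> cf; rewrite -box_integral12// box_integral21. Qed.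

End ContinuousFunctions.

Section ContTac.
Context {R : realType}.

Lemma cont_id (T : topologicalType) : continuous (fun x : T => x).
Proof. by move=> x; exact: cvg_id. Qed.

Lemma cont_fst0 (S T : topologicalType) : continuous (fun p : S * T => p.1).
Proof. by move=> p; exact: cvg_fst. Qed.

Lemma cont_snd0 (S T : topologicalType) : continuous (fun p : S * T => p.2).
Proof. by move=> p; exact: cvg_snd. Qed.

Lemma cont_segint (a b : R) (F : R -> R -> R) : continuous (fun p => F p.1 p.2) ->
  continuous (fun y => segint a b (fun x => F x y)).
Proof. by move=> cF; exact: (@cont_segint1 _ a b (fun p => F p.1 p.2)). Qed.

End ContTac.

(** One step of a proof of continuity, directed by the outermost operation of the
    function; a function without such an operation is assumed continuous or constant. *)
Ltac cont_step :=
  lazymatch goal with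
  | |- continuous (fun x => x) => exact: cont_id
  | |- continuous (fun x => x.1) => exact: cont_fst0
  | |- continuous (fun x => x.2) => exact: cont_snd0
  | |- continuous (fun x => @?f x + @?g x) => apply: (@contD _ _ f g)
  | |- continuous (fun x => - @?f x) => apply: (@contN _ _ f)
  | |- continuous (fun x => @?f x * @?g x) => apply: (@contM _ _ f g)
  | |- continuous (fun x => @?f x ^+ ?n) => apply: (@contX _ _ f n)
  | |- continuous (fun x => (@?f x, @?g x)) => apply: (@cont_pair _ _ _ f g)
  | |- continuous (fun x => segint ?a ?b (fun s => @?F x s)) =>
      apply: cont_segint
  | H : continuous ?f |- continuous (fun x => ?f (@?g x)) => apply: (@cont_comp _ _ _ f g H)
  | H : continuous ?f |- continuous ?f => exact: H
  | |- _ => exact: cont_cst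
  end.
Ltac cont := solve [repeat (cbn [fst snd]; cont_step)].

(** * Rotation invariance of the Lebesgue measure of the plane *)

Section Transfer.
Context {R : realType} d (T : measurableType d).
Variables (mu : {measure set T -> \bar R}) (phi : T -> T).

Lemma integral_preserving (D : set T) (f : T -> \bar R) :
  measurable_fun setT phi -> (forall A, measurable A -> mu (phi @^-1` A) = mu A) ->
  measurable D -> measurable_fun setT f -> mu.-integrable (phi @^-1` D) (f \o phi) ->
  mu.-integrable D f /\ (\int[mu]_(y in D) f y = \int[mu]_(x in phi @^-1` D) (f \o phi) x)%E.
Proof.
move=> mphi muphi mD mf i.
have IE g : (\int[pushforward mu phi]_(y in D) g y = \int[mu]_(y in D) g y)%E.
  by apply: eq_measure_integral => //= A mA _; exact: muphi.
split; last by rewrite -(integral_pushforward mphi mf i mD) IE.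
have /integrableP[m1 m2] := integrable_pushforward mphi mf i mD.
by apply/integrableP; split => //; rewrite -IE.
Qed.

End Transfer.

Section Rotation.
Context {R : realType}.
Implicit Types (a b c d k s t : R) (A : set (R * R)).

Lemma lebesgue_measure_translate c (A : set R) : measurable A ->
  pushforward (leb1 R) ((fun x => x + c) : R -> measurableTypeR R) A = leb1 R A.
Proof.
move=> mA; apply/esym/lebesgue_measure_unique => //=.
  by apply: measurable_funD.
move=> ? _ [[a b]] _ <-; rewrite /pushforward.
rewrite (_ : _ @^-1` _ = `]a - c, b - c]%classic); last first.
  by apply/seteqP; split => x /=; rewrite !in_itv/= ltrBlDr lerBrDr.
rewrite !lebesgue_measure_itv/= !lte_fin ltrD2r; case: ifPn => // _.
by rewrite -!EFinB opprB addrA subrK.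
Qed.

Definition shearx k (p : R * R) : R * R := (p.1 + k * p.2, p.2).
Definition sheary k (p : R * R) : R * R := (p.1, p.2 + k * p.1).

Lemma leb2_sheary k A : measurable A -> leb2 R (sheary k @^-1` A) = leb2 R A.
Proof.
move=> mA; rewrite /= /product_measure1; apply: eq_integral => x _ /=.
rewrite -(lebesgue_measure_translate (k * x) (measurable_xsection x mA)).
by congr (leb1 R _); apply/seteqP; split.
Qed.

Lemma leb2E21 A : measurable A -> leb2 R A = product_measure2 (leb1 R) (leb1 R) A.
Proof.
move=> mA; apply: product_measure_unique => // B C mB mC.
by rewrite /= product_measure2E.
Qed.

Lemma cont_shearx k : continuous (shearx k).
Proof.
apply: cont_pair; last by move=> p; exact: cvg_snd.
apply: contD; first by move=> p; exact: cvg_fst.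
by apply: contM; [exact: cont_cst|move=> p; exact: cvg_snd].
Qed.

Lemma continuous_measurable2_map (f : R * R -> R * R) : continuous f -> measurable_fun setT f.
Proof.
move=> cf; apply/measurable_fun_pairP; split; apply: continuous_measurable2;
  by apply: (cont_comp _ cf) => p; first [exact: cvg_fst|exact: cvg_snd].
Qed.

Lemma cont_preimage (f : R * R -> R * R) A : continuous f -> measurable A ->
  measurable (f @^-1` A).
Proof. by move=> cf mA; rewrite -[X in measurable X]setTI; apply: continuous_measurable2_map. Qed.

Lemma leb2_shearx k A : measurable A -> leb2 R (shearx k @^-1` A) = leb2 R A.
Proof.
move=> mA; rewrite !leb2E21//; last exact: (cont_preimage (@cont_shearx k) mA).
rewrite /product_measure2; apply: eq_integral => y _ /=.
rewrite -(lebesgue_measure_translate (k * y) (measurable_ysection y mA)).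
by congr (leb1 R _); apply/seteqP; split.
Qed.

(** With [s = tan (t / 2)], the horizontal shears of ratio [- s] surround the vertical
    shear of ratio [sin t]. A shear translates the lines parallel to an axis, so that
    rotation invariance reduces to translation invariance on the line. *)
Lemma rot_shear t : 1 + cos t != 0 ->
  rot t = shearx (- sin t / (1 + cos t)) \o sheary (sin t) \o shearx (- sin t / (1 + cos t)).
Proof.
move=> t0; apply/funext => -[x y]; rewrite /rot /shearx /sheary /=.
have e := cos2Dsin2 t.
have e2 : sin t ^+ 2 = (1 - cos t) * (1 + cos t) by rewrite -(addrK (cos t ^+ 2) (sin t ^+2)) [sin t ^+ 2 + _]addrC e; ring.
congr pair.
  have -> : x + - sin t / (1 + cos t) * y +
     - sin t / (1 + cos t) * (y + sin t * (x + - sin t / (1 + cos t) * y)) =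
     x - (sin t ^+ 2) / (1 + cos t) * x + (- sin t / (1 + cos t)) * (2 - sin t ^+ 2 / (1 + cos t)) * y by field.
  by rewrite e2 mulfK//; field.
have -> : y + sin t * (x + - sin t / (1 + cos t) * y) =
     sin t * x + (1 - (sin t ^+ 2) / (1 + cos t)) * y by field.
by rewrite e2 mulfK//; field.
Qed.

Lemma cont_sheary k : continuous (sheary k).
Proof.
apply: cont_pair; first by move=> p; exact: cvg_fst.
apply: contD; first by move=> p; exact: cvg_snd.
by apply: contM; [exact: cont_cst|move=> p; exact: cvg_fst].
Qed.

Lemma cont_rot t : continuous (rot t).
Proof.
apply: cont_pair.
  apply: contB; apply: contM; try exact: cont_cst; move=> p; first [exact: cvg_fst|exact: cvg_snd].
apply: contD; apply: contM; try exact: cont_cst; move=> p; first [exact: cvg_fst|exact: cvg_snd].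
Qed.

Lemma rotateD s t (p : R * R) : rot s (rot t p) = rot (s + t) p.
Proof. by rewrite /rot /= sinD cosD; congr pair; ring. Qed.

Lemma rotate0 (p : R * R) : rot 0 p = p.
Proof. by case: p => x y; rewrite /rot sin0 cos0 /=; congr pair; ring. Qed.

Lemma rotateK t : cancel (rot t) (rot (- t)).
Proof. by move=> p; rewrite rotateD addNr rotate0. Qed.

Lemma rotateNK t : cancel (rot (- t)) (rot t).
Proof. by move=> p; rewrite rotateD addrN rotate0. Qed.

(** The half-turn, which is not a product of such shears, is the square of a
    quarter-turn. *)
Lemma leb2_rot t A : measurable A -> leb2 R (rot t @^-1` A) = leb2 R A.
Proof.
have H s B : 1 + cos s != 0 -> measurable B -> leb2 R (rot s @^-1` B) = leb2 R B.
  move=> s0 mB; rewrite (rot_shear s0) !comp_preimage leb2_shearx.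
    rewrite leb2_sheary ?leb2_shearx//.
    by apply: (cont_preimage (@cont_shearx _)).
  by apply: (cont_preimage (@cont_sheary _)); apply: (cont_preimage (@cont_shearx _)).
move=> mA; have [t0|] := eqVneq (1 + cos t) 0; last by move=> /H; exact.
have e : cos t = 2 * cos (t / 2) ^+ 2 - 1 by rewrite {1}(splitr t) cosD; have := cos2Dsin2 (t / 2); rewrite -!expr2 => h; lra.
have h0 : cos (t / 2) = 0.
  apply/eqP; rewrite -[_ == _](expf_eq0 _ 2) ; apply/eqP; lra.
have h1 : 1 + cos (t / 2) != 0 by rewrite h0 addr0 oner_neq0.
have -> : rot t = rot (t / 2) \o rot (t / 2).
  by apply/funext => p /=; rewrite rotateD -splitr.
rewrite comp_preimage H// ?H//.
exact: (cont_preimage (@cont_rot _)).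
Qed.

Lemma domainE (Q : rectangle R) :
  domain Q = rot (- rangle Q) @^-1` box (rleft Q) (rright Q) (rbottom Q) (rtop Q).
Proof.
apply/seteqP; split => p.
  by move=> [q bq <-] /=; rewrite rotateK.
by move=> /= h; exists (rot (- rangle Q) p) => //; rewrite rotateNK.
Qed.

Lemma measurable_domain (Q : rectangle R) : measurable (domain Q).
Proof. by rewrite domainE; apply: (cont_preimage (@cont_rot _)); exact: measurable_box. Qed.

Lemma rot_domain (Q : rectangle R) :
  rot (rangle Q) @^-1` domain Q = box (rleft Q) (rright Q) (rbottom Q) (rtop Q).
Proof. by rewrite domainE -comp_preimage; apply/seteqP; split => p /=; rewrite rotateK. Qed.

Lemma integral_domain (Q : rectangle R) (f : R * R -> R) : continuous f ->
  (leb2 R).-integrable (domain Q) (EFin \o f) /\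
  \int[leb2 R]_(p in domain Q) f p =
  \int[leb2 R]_(p in box (rleft Q) (rright Q) (rbottom Q) (rtop Q)) f (rot (rangle Q) p).
Proof.
move=> cf; set t := rangle Q.
pose T2 : measurableType _ := (measurableTypeR R * measurableTypeR R)%type.
have mrot : measurable_fun (setT : set T2) (rot t : T2 -> T2).
  by apply: continuous_measurable2_map; exact: cont_rot.
have mf : measurable_fun (setT : set T2) (EFin \o f : T2 -> \bar R).
  by apply/measurable_EFinP; exact: continuous_measurable2.
have mD : measurable (domain Q : set T2) by exact: measurable_domain.
have ib : (leb2 R).-integrable (rot t @^-1` domain Q) ((EFin \o f) \o rot t).
  by rewrite rot_domain; apply: (@cont_integrable_box R _ _ _ _ (f \o rot t)); apply: (cont_comp cf); exact: cont_rot.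
have mrotE (A : set T2) : measurable A -> leb2 R ((rot t : T2 -> T2) @^-1` A) = leb2 R A.
  by move=> mA; exact: leb2_rot.
have [i e] := integral_preserving mrot mrotE mD mf ib.
by split; rewrite // /Rintegral e rot_domain.
Qed.

End Rotation.

(** * Robin modes of a segment *)

Section OneDim.
Context {R : realType}.
Implicit Types (a b c k l t beta : R) (f g : R -> R).

Definition C1fun f (f' : R -> R) : Prop :=
  (forall x : R, is_derive x 1 f (f' x)) /\ continuous f'.

Lemma derive_cont f (f' : R -> R) : (forall x : R, is_derive x 1 f (f' x)) -> continuous f.
Proof.
by move=> df x; apply/differentiable_continuous/derivable1_diffP/ex_derive.
Qed.

Lemma C1fun_cont f f' : C1fun f f' -> continuous f.
Proof. by case=> /derive_cont. Qed.

Lemma segint_split a b c f : continuous f -> a <= b <= c ->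
  segint a c f = segint a b f + segint b c f.
Proof.
move=> cf /andP[ab bc].
have := @Rintegral_itvB R f (BLeft a) (BRight c) b (cont_integrable a c cf).
rewrite !bnd_simp => /(_ ab bc).
rewrite Rintegral_itv_obnd_cbnd; first by rewrite /segint => <-; rewrite addrC subrK.
apply: (integrableS _ _ _ (cont_integrable b c cf)) => //.
by apply: subset_itvr; rewrite bnd_simp.
Qed.

Lemma is_derive_cont1 (x : R) f l : is_derive x 1 f l -> {for x, continuous f}.
Proof. by move=> df; apply/differentiable_continuous/derivable1_diffP/ex_derive. Qed.

(** Picone: let [rho] be the logarithmic derivative of the positive solution
    [cos (t + k * (x - a))] of [u'' = - k ^+ 2 * u]. In the nonnegative square
    [(f' - f * rho) ^+ 2], the terms other than [f' ^+ 2 - k ^+ 2 * f ^+ 2] form the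
    derivative of [- f ^+ 2 * rho]. *)
Lemma picone a b k t f f' : a < b -> C1fun f f' -> 0 <= k ->
  - (pi / 2) < t -> t + k * (b - a) < pi / 2 ->
  k ^+ 2 * segint a b (fun x => f x ^+ 2) + k * tan t * f a ^+ 2
    <= segint a b (fun x => f' x ^+ 2) + k * tan (t + k * (b - a)) * f b ^+ 2.
Proof.
move=> ab [df cf'] k0 ta tb; have cf := derive_cont df.
pose th (x : R) := t + k * (x - a).
pose rho x := - (k * tan (th x)).
have thr x : a <= x <= b -> 0 < cos (th x).
  move=> /andP[ax xb]; apply: cos_gt0_pihalf; apply/andP; split.
    by apply: (lt_le_trans ta); rewrite lerDl mulr_ge0// subr_ge0.
  by apply: le_lt_trans tb; rewrite lerD2l ler_wpM2l// lerD2r.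
have drho x : a <= x <= b -> is_derive x 1 rho (- k ^+ 2 - rho x ^+ 2).
  move=> /thr /lt0r_neq0 cx.
  have dth : is_derive x 1 th k.
    by rewrite /th; apply: is_derive_eq; rewrite /GRing.scale/=; ring.
  have dtan := is_derive_tan cx.
  rewrite /rho; apply: is_derive_eq.
  rewrite /GRing.scale/= cos2_tan2//; ring.
pose G x := f x ^+ 2 * rho x.
pose g x := 2 * f x * f' x * rho x + f x ^+ 2 * (- k ^+ 2 - rho x ^+ 2).
have dG x : a <= x <= b -> is_derive x 1 G (g x).
  move=> xab; have d1 := drho x xab; have d2 := df x.
  by rewrite /G; apply: is_derive_eq; rewrite /GRing.scale/= /g; ring.
have cg x : a <= x <= b -> {for x, continuous g}.
  move=> xab; have cr := is_derive_cont1 (drho x xab).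
  have cfx := cf x; have cfx' := cf' x.
  apply: cvgD.
    by apply: cvgM => //; apply: cvgM => //; apply: cvgM => //; exact: cvg_cst.
  have cf2 : {for x, continuous (fun y => f y ^+ 2)} by exact: contX.
  have cr2 : {for x, continuous (fun y => rho y ^+ 2)}.
    exact: (@continuous_comp _ _ _ rho (fun y => y ^+ 2) x cr (@exprn_continuous _ 2 _)).
  by apply: cvgM cf2 _; apply: cvgB cr2; exact: cvg_cst.
have wg : {within `[a, b], continuous g}.
  apply: continuous_in_subspaceT => x; rewrite inE/= in_itv/=; exact: cg.
have aab : a <= a <= b by rewrite lexx ltW.
have bab : a <= b <= b by rewrite lexx ltW.
have key : segint a b g <= segint a b (fun x => f' x ^+ 2 - k ^+ 2 * f x ^+ 2).
  apply: le_Rintegral; first exact: measurable_itv.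
  - by apply: continuous_compact_integrable => //; exact: segment_compact.
  - apply: cont_integrable; apply: contB; first exact: contX.
    by apply: contM; [exact: cont_cst|exact: contX].
  - move=> x _; rewrite -subr_ge0.
    have -> : f' x ^+ 2 - k ^+ 2 * f x ^+ 2 - g x = (f' x - f x * rho x) ^+ 2.
      by rewrite /g; ring.
    exact: sqr_ge0.
have Ga : G a = f a ^+ 2 * rho a by [].
have Gb : G b = f b ^+ 2 * rho b by [].
clearbody G g.
have Gca : {for a, continuous G} := is_derive_cont1 (dG a aab).
have Gcb : {for b, continuous G} := is_derive_cont1 (dG b bab).
have FTC : segint a b g = G b - G a.
  rewrite /segint /Rintegral (@continuous_FTC2 _ g G)//.
  - split.
    + by move=> x; rewrite in_itv/= => /andP[/ltW ax /ltW xb]; apply: ex_derive; apply: dG; rewrite ax.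
    + by apply: cvg_at_right_filter; exact: Gca.
    + by apply: cvg_at_left_filter; exact: Gcb.
  - move=> x; rewrite in_itv/= => /andP[/ltW ax /ltW xb].
    have dGx : is_derive x 1 G (g x) by apply: dG; rewrite ax.
    by rewrite derive1E derive_val.
move: key; rewrite FTC segintB; last 2 first.
- exact: contX.
- by apply: contM; [exact: cont_cst|exact: contX].
rewrite segintZ; last exact: contX.
rewrite Ga Gb /rho /th subrr mulr0 addr0.
set I1 := segint _ _ _; set I2 := segint _ _ _; lra.
Qed.

(** ** Robin eigenvalues on a segment *)

Definition robin_energy beta a b f f' : R :=
  segint a b (fun x => f' x ^+ 2) + beta * (f a ^+ 2 + f b ^+ 2).

(** An eigenfunction on [[a, b]] for the eigenvalue [k ^+ 2], together with its
    derivative; requiring the differential equation on the whole line keeps modes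
    continuous everywhere. *)
Definition robin_mode beta a b k f f' : Prop :=
  [/\ forall x : R, is_derive x 1 f (f' x),
      forall x : R, is_derive x 1 f' (- (k ^+ 2 * f x)),
      f' a = beta * f a & f' b = - (beta * f b)].

Lemma robin_modeC1 beta a b k f f' : robin_mode beta a b k f f' -> C1fun f f'.
Proof. by case=> d1 d2 _ _; split => //; exact: derive_cont d2. Qed.

Lemma robin_modeZ beta a b k c f f' : robin_mode beta a b k f f' ->
  robin_mode beta a b k (fun x => c * f x) (fun x => c * f' x).
Proof.
case=> d1 d2 ha hb; split.
- by move=> x; have := d1 x => d; apply: is_derive_eq; rewrite /GRing.scale/=; ring.
- by move=> x; have := d2 x => d; apply: is_derive_eq; rewrite /GRing.scale/=; ring.
- by rewrite ha; ring.
- by rewrite hb; ring.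
Qed.

Lemma C1funB f f' g g' : C1fun f f' -> C1fun g g' ->
  C1fun (fun x => f x - g x) (fun x => f' x - g' x).
Proof.
move=> [df cf'] [dg cg']; split; last exact: contB.
by move=> x; have := df x; have := dg x => d1 d2; apply: is_derive_eq.
Qed.

Lemma C1funZ c f f' : C1fun f f' -> C1fun (fun x => c * f x) (fun x => c * f' x).
Proof.
move=> [df cf']; split; last by apply: contM; [exact: cont_cst|].
by move=> x; have := df x => d; apply: is_derive_eq; rewrite /GRing.scale/=; ring.
Qed.

(** Integrate the derivative of [f * phi'], and express [phi'] at the endpoints by the
    Robin conditions. *)
Lemma robin_mode_weak beta a b k phi phi' f f' : a < b ->
  robin_mode beta a b k phi phi' -> C1fun f f' ->
  segint a b (fun x => f' x * phi' x) + beta * (f a * phi a + f b * phi b) =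
  k ^+ 2 * segint a b (fun x => f x * phi x).
Proof.
move=> ab [d1 d2 ha hb] [df cf'].
have cf := derive_cont df; have cp := derive_cont d1; have cp' := derive_cont d2.
have := @segint_FTC R a b (fun x => f x * phi' x)
  (fun x => f' x * phi' x - k ^+ 2 * (f x * phi x)) ab.
rewrite segintB; last 2 first.
- exact: contM.
- by apply: contM; [exact: cont_cst|exact: contM].
rewrite segintZ; last exact: contM.
rewrite hb ha => H.
have {}H := H (contB (contM cf' cp') (contM (@cont_cst R R (k ^+ 2)) (contM cf cp))).
move: H; set I1 := segint _ _ _; set I2 := segint _ _ _ => H.
suff : I1 - k ^+ 2 * I2 = f b * - (beta * phi b) - f a * (beta * phi a) by lra.
apply: H => x; have := df x; have := d2 x => e1 e2.
by apply: is_derive_eq; rewrite /GRing.scale/=; ring.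
Qed.

Lemma tan_compl_atan (x : R) : 0 < x -> tan (pi / 2 - atan x) = x^-1.
Proof.
move=> x0; have c0 : cos (atan x) != 0 by rewrite cos_atan invr_eq0 sqrtr_eq0 -ltNge ltr_wpDr// sqr_ge0.
rewrite /tan sinB cosB sin_pihalf cos_pihalf !mul1r !mul0r subr0 add0r.
have -> : sin (atan x) = x * cos (atan x) by rewrite -{2}(atanK x) /tan divfK.
by rewrite invfM mulrCA mulfV// mulr1.
Qed.

(** Comparison with [cos (k * (x - m))], where [m] is the midpoint: the equation
    satisfied by [k] turns the boundary terms of [picone] into those of the Robin
    energy. *)
Lemma robin1_lower beta a b k f f' : 0 < beta -> a < b -> 0 < k ->
  k * ((b - a) / 2) + atan (k / beta) = pi / 2 -> C1fun f f' ->
  k ^+ 2 * segint a b (fun x => f x ^+ 2) <= robin_energy beta a b f f'.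
Proof.
move=> b0 ab k0 kE f1.
have kb : 0 < k / beta by rewrite divr_gt0.
have tE : k * ((b - a) / 2) = pi / 2 - atan (k / beta) by rewrite -kE addrK.
have at0 : 0 < atan (k / beta) by rewrite -[ltLHS](@atan0 R) lt_atan.
have tT : tan (k * ((b - a) / 2)) = beta / k by rewrite tE tan_compl_atan// invf_div.
have := @picone a b k (- (k * ((b - a) / 2))) f f' ab f1 (ltW k0).
rewrite tanN tT; have -> : - (k * ((b - a) / 2)) + k * (b - a) = k * ((b - a) / 2) by field.
rewrite tT /robin_energy => /(_ _ _).
have -> : k * - (beta / k) = - beta by field; rewrite gt_eqF.
have -> : k * (beta / k) = beta by field; rewrite gt_eqF.
move=> H; have {}H := H _ _.
suff : k ^+ 2 * segint a b (fun x => f x ^+ 2) + - beta * f a ^+ 2 <= segint a b (fun x => f' x ^+ 2) + beta * f b ^+ 2 by lra.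
by apply: H; rewrite tE; lra.
Qed.

(** Limit of the inequalities as [e] tends to 0. *)
Lemma robin2_half l k X Y : 0 < k -> 0 < l ->
  (forall e, 0 < e -> e < k * l -> (k - e / l) ^+ 2 * X <= Y) -> 0 <= X ->
  k ^+ 2 * X <= Y.
Proof.
move=> k0 l0 H X0; apply/ler_addgt0Pr => d d0.
(* The loss [2 * k * (e / l) * X] must not exceed [d]. *)
pose e := Num.min (k * l / 2) (d * l / (2 * k * X + 1)).
have den : 0 < 2 * k * X + 1 by rewrite ltr_wpDl// mulr_ge0// mulr_ge0// ltW.
have e0 : 0 < e by rewrite lt_min; apply/andP; split; apply: divr_gt0 => //; exact: mulr_gt0.
have ekl : e < k * l.
  rewrite gt_min; apply/orP; left; rewrite ltr_pdivrMr// ltr_pMr ?mulr_gt0//; lra.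
have := H e e0 ekl.
have ed : e / l * (2 * k * X + 1) <= d.
  rewrite -ler_pdivlMr// ler_pdivrMr// mulrAC ge_min; apply/orP; right.
  by rewrite mulrAC.
have el : 0 <= e / l by rewrite divr_ge0// ltW.
have : 0 <= (e / l) ^+ 2 * X by rewrite mulr_ge0// sqr_ge0.
nra.
Qed.

(** On each half of the segment, compare with the odd mode [sin (k * (x - m))]. As this
    function vanishes at the midpoint [m], it is first shifted by a phase [e], at the
    price of lowering its frequency to [k - e / l]; the boundary term at [m] disappears
    with [f m]. *)
Lemma robin2_vanish beta a b k f f' : 0 < beta -> a < b -> 0 < k ->
  k * ((b - a) / 2) + atan (k / beta) = pi -> C1fun f f' -> f ((a + b) / 2) = 0 ->
  k ^+ 2 * segint a b (fun x => f x ^+ 2) <= robin_energy beta a b f f'.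
Proof.
move=> b0 ab k0 kE f1 fm; set m := (a + b) / 2 in fm *; set l := (b - a) / 2 in kE *.
have l0 : 0 < l by rewrite divr_gt0// subr_gt0.
have am : a < m by rewrite /m; lra.
have mb : m < b by rewrite /m; lra.
have bm : b - m = l by rewrite /m /l; field.
have ma : m - a = l by rewrite /m /l; field.
have [df cf'] := f1; have cf := C1fun_cont f1.
have kb : 0 < k / beta by rewrite divr_gt0.
have at0 : 0 < atan (k / beta) by rewrite -[ltLHS](@atan0 R) lt_atan.
have at1 := atan_ltpi2 (k / beta).
have pi0 := @pi_gt0 R.
have tT : tan (pi / 2 - atan (k / beta)) = beta / k by rewrite tan_compl_atan// invf_div.
have bk0 : 0 < beta / k by rewrite divr_gt0.
have small e : 0 < e -> e < k * l -> 0 <= k - e / l /\ (k - e / l) * (beta / k) <= beta.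
  move=> e0 ekl; have el : e / l < k by rewrite ltr_pdivrMr.
  split; first by rewrite subr_ge0 ltW.
  rewrite -[leRHS](@divfK _ k)// ?gt_eqF// [leRHS]mulrC ler_wpM2r ?ltW//.
  by rewrite ltrBlDr ltrDl divr_gt0.
have right : k ^+ 2 * segint m b (fun x => f x ^+ 2) <=
    segint m b (fun x => f' x ^+ 2) + beta * f b ^+ 2.
  apply: (robin2_half k0 l0); last by apply: segint_ge0 => x _; exact: sqr_ge0.
  move=> e e0 ekl; have [k'0 k'b] := small e e0 ekl.
  (* The phase runs from [e - pi / 2] at [m] to [pi / 2 - atan (k / beta)] at [b]. *)
  have := @picone m b (k - e / l) (e - pi / 2) f f' mb f1 k'0.
  rewrite bm fm expr0n/= mulr0 addr0.
  have -> : e - pi / 2 + (k - e / l) * l = pi / 2 - atan (k / beta).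
    rewrite mulrBl divfK ?gt_eqF//; move: kE; lra.
  rewrite tT => H; apply: (le_trans (H _ _)); [lra|lra|].
  by rewrite lerD2l ler_wpM2r// sqr_ge0.
have left : k ^+ 2 * segint a m (fun x => f x ^+ 2) <=
    segint a m (fun x => f' x ^+ 2) + beta * f a ^+ 2.
  apply: (robin2_half k0 l0); last by apply: segint_ge0 => x _; exact: sqr_ge0.
  move=> e e0 ekl; have [k'0 k'b] := small e e0 ekl.
  have := @picone a m (k - e / l) (- (pi / 2 - atan (k / beta))) f f' am f1 k'0.
  rewrite ma fm expr0n/= mulr0 addr0 tanN tT.
  have -> : - (pi / 2 - atan (k / beta)) + (k - e / l) * l = pi / 2 - e.
    rewrite mulrBl divfK ?gt_eqF//; move: kE; lra.
  rewrite mulrN mulNr => H.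
  rewrite -lerBlDr; apply: (le_trans _ (H _ _)); [|lra|lra].
  by rewrite lerB// ler_wpM2r// sqr_ge0.
rewrite /robin_energy.
rewrite (@segint_split a m b); [|exact: contX|by rewrite !ltW].
rewrite (@segint_split a m b (fun x => f' x ^+ 2)); [|exact: contX|by rewrite !ltW].
move: left right; set I1 := segint _ _ _; set I2 := segint _ _ _.
set I3 := segint _ _ _; set I4 := segint _ _ _; lra.
Qed.

Lemma segint_sqrB a b c f g : continuous f -> continuous g ->
  segint a b (fun x => (f x - c * g x) ^+ 2) =
  segint a b (fun x => f x ^+ 2) - 2 * c * segint a b (fun x => f x * g x)
  + c ^+ 2 * segint a b (fun x => g x ^+ 2).
Proof.
move=> cf cg; rewrite -!segintZ; [|exact: contX|exact: contM].
have e1 : continuous (fun x => f x ^+ 2) by exact: contX.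
have e2 : continuous (fun x => 2 * c * (f x * g x)) by apply: contM; [exact: cont_cst|exact: contM].
have e3 : continuous (fun x => c ^+ 2 * g x ^+ 2) by apply: contM; [exact: cont_cst|exact: contX].
rewrite -segintB// -segintD//; last exact: contB.
by apply: eq_segint => x _; ring.
Qed.

(** The function [f - c * phi] vanishes at the midpoint for a suitable [c], and
    [robin2_vanish] applies to it. By the weak equation of [phi], expanding the energy
    and the norm of [f - c * phi] only involves [c] through [(c - F) ^+ 2], where [F] is
    the scalar product of [f] and [phi]. *)
Lemma robin2_lower beta a b k1 k2 phi phi' f f' : 0 < beta -> a < b ->
  0 < k1 -> k1 <= k2 -> k2 * ((b - a) / 2) + atan (k2 / beta) = pi ->
  robin_mode beta a b k1 phi phi' -> phi ((a + b) / 2) != 0 ->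
  segint a b (fun x => phi x ^+ 2) = 1 -> C1fun f f' ->
  k2 ^+ 2 * segint a b (fun x => f x ^+ 2)
    - (k2 ^+ 2 - k1 ^+ 2) * segint a b (fun x => f x * phi x) ^+ 2
  <= robin_energy beta a b f f'.
Proof.
move=> b0 ab k10 k12 k2E mphi pm pN f1.
have phi1 := robin_modeC1 mphi.
have cf := C1fun_cont f1; have cp := C1fun_cont phi1.
have [_ cf'] := f1; have [_ cp'] := phi1.
pose c := f ((a + b) / 2) / phi ((a + b) / 2).
have g1 := C1funB f1 (C1funZ c phi1).
have k20 : 0 < k2 by exact: lt_le_trans k12.
have := robin2_vanish b0 ab k20 k2E g1.
rewrite /c divfK// subrr -/c => /(_ erefl).
have W1 := robin_mode_weak ab mphi f1.
have W2 := robin_mode_weak ab mphi phi1.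
rewrite /robin_energy !segint_sqrB//.
have pN' : segint a b (fun x => phi x * phi x) = 1 by rewrite -pN; apply: eq_segint => x _; rewrite expr2.
rewrite pN' in W2; rewrite pN.
have k12' : 0 <= k2 ^+ 2 - k1 ^+ 2 by rewrite subr_ge0 ler_pXn2r// nnegrE ltW.
move: W1 W2; set F := segint a b (fun x => f x * phi x); set I1 := segint _ _ _; set I2 := segint _ _ _.
move=> W1 W2; rewrite expr2 in W2 *.
have : 0 <= (k2 ^+ 2 - k1 ^+ 2) * (c - F) ^+ 2 by rewrite mulr_ge0// sqr_ge0.
set I3 := segint _ _ _; set I4 := segint _ _ _.
nra.
Qed.

(** By its weak equation, [k ^+ 2] times the squared norm of a mode is its energy, which
    contains the term [beta * phi b ^+ 2]. *)
Lemma robin_mode_norm beta a b k phi phi' : 0 < beta -> a < b -> 0 < k ->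
  robin_mode beta a b k phi phi' -> phi b != 0 ->
  0 < segint a b (fun x => phi x ^+ 2).
Proof.
move=> b0 ab k0 mp pb; have := robin_mode_weak ab mp (robin_modeC1 mp).
have -> : segint a b (fun x => phi x * phi x) = segint a b (fun x => phi x ^+ 2).
  by apply: eq_segint => x _; rewrite expr2.
move=> W; rewrite -(@pmulr_rgt0 _ (k ^+ 2)) ?exprn_gt0// -W.
rewrite ltr_wpDl//; first by apply: segint_ge0 => x _; rewrite -expr2 sqr_ge0.
rewrite mulr_gt0// ltr_wpDl// -expr2 ?sqr_ge0//.
by rewrite exprn_even_gt0.
Qed.

Lemma robin_mode_normalize beta a b k phi phi' : 0 < beta -> a < b -> 0 < k ->
  robin_mode beta a b k phi phi' -> phi b != 0 ->
  exists c, [/\ c != 0, robin_mode beta a b k (fun x => c * phi x) (fun x => c * phi' x) &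
    segint a b (fun x => (c * phi x) ^+ 2) = 1].
Proof.
move=> b0 ab k0 mp pb; have N0 := robin_mode_norm b0 ab k0 mp pb.
set N := segint _ _ _ in N0; exists (Num.sqrt N)^-1; split.
- by rewrite invr_eq0 sqrtr_eq0 -ltNge.
- exact: robin_modeZ.
- have cp := C1fun_cont (robin_modeC1 mp).
  transitivity (segint a b (fun x => N^-1 * phi x ^+ 2)).
    by apply: eq_segint => x _; rewrite exprMn exprVn sqr_sqrtr// ltW.
  by rewrite segintZ ?mulVf ?gt_eqF//; exact: contX.
Qed.

(** The even mode [cos (k * (x - m))], where [m] is the midpoint. *)
Lemma robin_mode1_exists beta a b k : 0 < beta -> a < b -> 0 < k ->
  k * ((b - a) / 2) + atan (k / beta) = pi / 2 ->
  exists phi phi', [/\ robin_mode beta a b k phi phi', phi ((a + b) / 2) != 0 &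
    segint a b (fun x => phi x ^+ 2) = 1].
Proof.
move=> b0 ab k0 kE; pose m := (a + b) / 2.
pose th (x : R) := k * (x - m).
have dth (x : R) : is_derive x 1 th k.
  by rewrite /th; apply: is_derive_eq; rewrite /GRing.scale/=; ring.
have thb : th b = pi / 2 - atan (k / beta) by rewrite -kE addrK /th /m; field.
have tha : th a = - th b by rewrite /th /m; field.
have ca : 0 < cos (atan (k / beta)).
  by rewrite cos_gt0_pihalf// atan_gtNpi2 atan_ltpi2.
have sa : sin (atan (k / beta)) = k / beta * cos (atan (k / beta)).
  by rewrite -{2}(atanK (k / beta)) /tan divfK// gt_eqF.
have sb : sin (th b) = cos (atan (k / beta)).
  by rewrite thb sinB sin_pihalf cos_pihalf mul1r mul0r subr0.
have cb : cos (th b) = k / beta * cos (atan (k / beta)).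
  by rewrite thb cosB sin_pihalf cos_pihalf mul1r mul0r add0r.
have mode : robin_mode beta a b k (fun x => cos (th x)) (fun x => - (k * sin (th x))).
  split.
  - move=> x; have d := is_derive1_comp (is_derive_cos (th x)) (dth x).
    by apply: is_derive_eq; rewrite /GRing.scale/=; ring.
  - move=> x; have d := is_derive1_comp (is_derive_sin (th x)) (dth x).
    by apply: is_derive_eq; rewrite /GRing.scale/=; ring.
  - by rewrite tha sinN cosN sb cb; field; rewrite gt_eqF.
  - by rewrite sb cb; field; rewrite gt_eqF.
have pb : cos (th b) != 0 by rewrite cb gt_eqF// mulr_gt0// divr_gt0.
have [c [c0 mc Nc]] := robin_mode_normalize b0 ab k0 mode pb.
eexists; eexists; split; [exact: mc| |exact: Nc].
by rewrite mulf_neq0// /th subrr mulr0 cos0 oner_neq0.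
Qed.

(** The odd mode [sin (k * (x - m))], where [m] is the midpoint. *)
Lemma robin_mode2_exists beta a b k : 0 < beta -> a < b -> 0 < k ->
  k * ((b - a) / 2) + atan (k / beta) = pi ->
  exists phi phi', robin_mode beta a b k phi phi' /\
    segint a b (fun x => phi x ^+ 2) = 1.
Proof.
move=> b0 ab k0 kE; pose m := (a + b) / 2.
pose th (x : R) := k * (x - m).
have dth (x : R) : is_derive x 1 th k.
  by rewrite /th; apply: is_derive_eq; rewrite /GRing.scale/=; ring.
have thb : th b = pi - atan (k / beta) by rewrite -kE addrK /th /m; field.
have tha : th a = - th b by rewrite /th /m; field.
have ca : 0 < cos (atan (k / beta)).
  by rewrite cos_gt0_pihalf// atan_gtNpi2 atan_ltpi2.
have sa : sin (atan (k / beta)) = k / beta * cos (atan (k / beta)).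
  by rewrite -{2}(atanK (k / beta)) /tan divfK// gt_eqF.
have sb : sin (th b) = k / beta * cos (atan (k / beta)).
  by rewrite thb sinB sinpi cospi sa; ring.
have cb : cos (th b) = - cos (atan (k / beta)).
  by rewrite thb cosB sinpi cospi; ring.
have mode : robin_mode beta a b k (fun x => sin (th x)) (fun x => k * cos (th x)).
  split.
  - move=> x; have d := is_derive1_comp (is_derive_sin (th x)) (dth x).
    by apply: is_derive_eq; rewrite /GRing.scale/=; ring.
  - move=> x; have d := is_derive1_comp (is_derive_cos (th x)) (dth x).
    by apply: is_derive_eq; rewrite /GRing.scale/=; ring.
  - by rewrite tha sinN cosN sb cb; field; rewrite gt_eqF.
  - by rewrite sb cb; field; rewrite gt_eqF.
have pb : sin (th b) != 0 by rewrite sb gt_eqF// mulr_gt0// divr_gt0.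
have [c [c0 mc Nc]] := robin_mode_normalize b0 ab k0 mode pb.
by eexists; eexists; split; [exact: mc|exact: Nc].
Qed.

(** The left-hand side of [robin_mode_weak] is symmetric in the two functions, so that
    it is the product of their scalar product with either eigenvalue. *)
Lemma robin_mode_orth beta a b k1 k2 p p' q q' : a < b -> k1 ^+ 2 != k2 ^+ 2 ->
  robin_mode beta a b k1 p p' -> robin_mode beta a b k2 q q' ->
  segint a b (fun x => q x * p x) = 0.
Proof.
move=> ab k12 mp mq.
have W1 := robin_mode_weak ab mp (robin_modeC1 mq).
have W2 := robin_mode_weak ab mq (robin_modeC1 mp).
have e1 : segint a b (fun x => p x * q x) = segint a b (fun x => q x * p x).
  by apply: eq_segint => x _; rewrite mulrC.
have e2 : segint a b (fun x => p' x * q' x) = segint a b (fun x => q' x * p' x).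
  by apply: eq_segint => x _; rewrite mulrC.
rewrite e1 e2 in W2.
have /eqP : (k1 ^+ 2 - k2 ^+ 2) * segint a b (fun x => q x * p x) = 0.
  by rewrite mulrBl -W1 -W2; ring.
by rewrite mulf_eq0 subr_eq0 (negPf k12) => /eqP.
Qed.

End OneDim.

(** * Lower bounds for the energy of a rectangle *)

Opaque segint.

Section TwoDim.
Context {R : realType}.
Implicit Types (a b c d k beta r : R) (V Vx Vy : R * R -> R).

(** The partial derivatives are data, so that a function of the plane can be studied in
    any rotated coordinates. *)
Definition C1plane V Vx Vy : Prop :=
  [/\ continuous V, continuous Vx, continuous Vy,
      forall x y : R, is_derive x 1 (fun s => V (s, y)) (Vx (x, y)) &
      forall x y : R, is_derive y 1 (fun s => V (x, s)) (Vy (x, y))].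

Definition plane_energy beta a b c d V Vx Vy : R :=
  segint c d (fun y => segint a b (fun x => Vx (x, y) ^+ 2 + Vy (x, y) ^+ 2))
  + beta * (segint a b (fun s => V (s, c) ^+ 2) + segint a b (fun s => V (s, d) ^+ 2)
    + segint c d (fun s => V (a, s) ^+ 2) + segint c d (fun s => V (b, s) ^+ 2)).

Definition norm2 a b c d V : R :=
  segint c d (fun y => segint a b (fun x => V (x, y) ^+ 2)).

(** Fubini's theorem, for the boundary terms too: the points of a vertical side are ends
    of horizontal sections. *)
Lemma plane_energyE beta a b c d V Vx Vy : C1plane V Vx Vy ->
  plane_energy beta a b c d V Vx Vy =
    segint c d (fun y => robin_energy beta a b (fun x => V (x, y)) (fun x => Vx (x, y)))
  + segint a b (fun x => robin_energy beta c d (fun y => V (x, y)) (fun y => Vy (x, y))).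
Proof.
move=> [cV cVx cVy _ _]; rewrite /plane_energy /robin_energy.
rewrite !segintD; try cont.
rewrite !segintZ; try cont.
rewrite !segintD; try cont.
rewrite (@segint_swap _ a b c d (fun p => Vy p ^+ 2)) /=; last cont.
rewrite (@eq_segint _ c d _ (fun y => segint a b (fun x => Vx (x, y) ^+ 2) + segint a b (fun x => Vy (x, y) ^+ 2))); last first.
  by move=> y _; rewrite segintD//; cont.
rewrite segintD; try cont.
move: (segint a b (fun s => V (s, c) ^+ 2)) (segint a b (fun s => V (s, d) ^+ 2))
  (segint c d (fun s => V (a, s) ^+ 2)) (segint c d (fun s => V (b, s) ^+ 2)) => I1 I2 I3 I4.
ring.
Qed.

Lemma plane_energy_ge1 beta a b c d k1 k1' V Vx Vy : 0 < beta -> a < b -> c < d ->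
  0 < k1 -> k1 * ((b - a) / 2) + atan (k1 / beta) = pi / 2 ->
  0 < k1' -> k1' * ((d - c) / 2) + atan (k1' / beta) = pi / 2 ->
  C1plane V Vx Vy ->
  (k1 ^+ 2 + k1' ^+ 2) * norm2 a b c d V <= plane_energy beta a b c d V Vx Vy.
Proof.
move=> b0 ab cd k0 kE k'0 k'E C; rewrite plane_energyE//.
have [cV cVx cVy dVx dVy] := C.
rewrite mulrDl; apply: lerD; rewrite /norm2.
  rewrite -segintZ; last cont.
  apply: le_segint; rewrite /robin_energy; try cont.
  move=> y _; apply: (robin1_lower b0 ab k0 kE); split; last cont.
  by move=> x; exact: dVx.
rewrite -(@segint_swap _ a b c d (fun p => V p ^+ 2)) /=; last cont.
rewrite -segintZ; last cont.
apply: le_segint; rewrite /robin_energy; try cont.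
move=> x _; apply: (robin1_lower b0 cd k'0 k'E); split; last cont.
by move=> y; exact: dVy.
Qed.

(** The square of the component of [f] orthogonal to [phi] has a nonnegative
    integral. *)
Lemma bessel a b (f phi : R -> R) : continuous f -> continuous phi ->
  segint a b (fun x => phi x ^+ 2) = 1 ->
  segint a b (fun x => f x * phi x) ^+ 2 <= segint a b (fun x => f x ^+ 2).
Proof.
move=> cf cp N; set r := segint a b (fun x => f x * phi x).
have : 0 <= segint a b (fun x => (f x - r * phi x) ^+ 2).
  by apply: segint_ge0 => x _; exact: sqr_ge0.
rewrite segint_sqrB// -/r N; lra.
Qed.

(** Let [P] and [S] be the orthogonal projections on [phi] in the variable [x] and on
    [psi] in the variable [y]. They commute, and the inequality is the positivity of
    [(1 - P) * (1 - S) = 1 - P - S + P * S]. *)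
Lemma bessel_tensor a b c d V (phi psi : R -> R) : continuous V ->
  continuous phi -> continuous psi ->
  segint a b (fun x => phi x ^+ 2) = 1 -> segint c d (fun y => psi y ^+ 2) = 1 ->
  segint c d (fun y => segint a b (fun x => V (x, y) * phi x) ^+ 2)
  + segint a b (fun x => segint c d (fun y => V (x, y) * psi y) ^+ 2)
  <= norm2 a b c d V
   + segint c d (fun y => segint a b (fun x => V (x, y) * (phi x * psi y))) ^+ 2.
Proof.
move=> cV cp cs Np Ns.
pose q x := segint c d (fun y => V (x, y) * psi y).
pose p y := segint a b (fun x => V (x, y) * phi x).
have cq : continuous q by rewrite /q; cont.
have cP : continuous p by rewrite /p; cont.
pose r := segint c d (fun y => segint a b (fun x => V (x, y) * (phi x * psi y))).
have rp : segint c d (fun y => p y * psi y) = r.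
  apply: eq_segint => y _; rewrite /p mulrC -segintZ; last cont.
  by apply: eq_segint => x _; ring.
have rq : segint a b (fun x => q x * phi x) = r.
  rewrite /r -(@segint_swap _ a b c d (fun p => V p * (phi p.1 * psi p.2))) /=; last cont.
  apply: eq_segint => x _; rewrite /q mulrC -segintZ; last cont.
  by apply: eq_segint => y _; ring.
have E1 : norm2 a b c d (fun p => V p - q p.1 * psi p.2) =
    norm2 a b c d V - segint a b (fun x => q x ^+ 2).
  rewrite /norm2 -(@segint_swap _ a b c d (fun p => (V p - q p.1 * psi p.2) ^+ 2)) /=; last cont.
  rewrite -(@segint_swap _ a b c d (fun p => V p ^+ 2)) /=; last cont.
  rewrite -segintB; try cont.
  apply: eq_segint => x _.
  rewrite (eq_segint (g := fun y => (V (x, y) - q x * psi y) ^+ 2))// segint_sqrB//; last cont.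
  by rewrite Ns -/(q x); ring.
have E2 : segint c d (fun y => (p y - r * psi y) ^+ 2) <=
    norm2 a b c d (fun p => V p - q p.1 * psi p.2).
  rewrite /norm2; apply: le_segint; try cont.
  move=> y _; have -> : p y - r * psi y = segint a b (fun x => (V (x, y) - q x * psi y) * phi x).
    rewrite -rq mulrC -segintZ; last cont.
    rewrite /p -segintB; try cont.
    by apply: eq_segint => x _; ring.
  by apply: bessel => //; cont.
have E3 : segint c d (fun y => (p y - r * psi y) ^+ 2) =
    segint c d (fun y => p y ^+ 2) - r ^+ 2.
  by rewrite segint_sqrB// Ns rp; ring.
rewrite -/r.
move: E1 E2 E3; lra.
Qed.

(** By [bessel], the gap [k2 ^+ 2 - k1 ^+ 2] in [robin2_lower] may be lowered to any
    [delta]; the second eigenvalue of a rectangle only involves the smaller of the gaps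
    of its two sides. *)
Lemma robin_deflated beta a b k1 k2 delta phi phi' f f' : 0 < beta -> a < b ->
  0 < k1 -> k1 <= k2 -> k2 * ((b - a) / 2) + atan (k2 / beta) = pi ->
  robin_mode beta a b k1 phi phi' -> phi ((a + b) / 2) != 0 ->
  segint a b (fun x => phi x ^+ 2) = 1 -> C1fun f f' -> delta <= k2 ^+ 2 - k1 ^+ 2 ->
  (k1 ^+ 2 + delta) * segint a b (fun x => f x ^+ 2)
    - delta * segint a b (fun x => f x * phi x) ^+ 2
  <= robin_energy beta a b f f'.
Proof.
move=> b0 ab k10 k12 k2E mp pm pN f1 dk.
apply: le_trans (robin2_lower b0 ab k10 k12 k2E mp pm pN f1).
have := bessel (C1fun_cont f1) (C1fun_cont (robin_modeC1 mp)) pN.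
rewrite -subr_ge0; set I := segint _ _ _; set J := segint _ _ _ => IJ.
have : 0 <= (k2 ^+ 2 - k1 ^+ 2 - delta) * (I - J ^+ 2) by rewrite mulr_ge0// subr_ge0.
lra.
Qed.

(** With [P] and [S] as in [bessel_tensor], the horizontal energy is at least
    [k1 ^+ 2 + delta * (1 - P)] and the vertical one at least
    [k1' ^+ 2 + delta * (1 - S)], while [(1 - P) + (1 - S)] is at least [1 - P * S]. *)
Lemma plane_energy_ge2 beta a b c d k1 k1' k2 k2' delta (phi phi' psi psi' : R -> R) V Vx Vy :
  0 < beta -> a < b -> c < d -> 0 <= delta ->
  0 < k1 -> k1 <= k2 -> k2 * ((b - a) / 2) + atan (k2 / beta) = pi ->
  delta <= k2 ^+ 2 - k1 ^+ 2 ->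
  robin_mode beta a b k1 phi phi' -> phi ((a + b) / 2) != 0 ->
  segint a b (fun x => phi x ^+ 2) = 1 ->
  0 < k1' -> k1' <= k2' -> k2' * ((d - c) / 2) + atan (k2' / beta) = pi ->
  delta <= k2' ^+ 2 - k1' ^+ 2 ->
  robin_mode beta c d k1' psi psi' -> psi ((c + d) / 2) != 0 ->
  segint c d (fun x => psi x ^+ 2) = 1 ->
  C1plane V Vx Vy ->
  (k1 ^+ 2 + k1' ^+ 2 + delta) * norm2 a b c d V
   - delta * segint c d (fun y => segint a b (fun x => V (x, y) * (phi x * psi y))) ^+ 2
   <= plane_energy beta a b c d V Vx Vy.
Proof.
move=> b0 ab cd d0 k10 k12 k2E dk mp pm pN k10' k12' k2E' dk' ms sm sN C.
rewrite plane_energyE//.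
have [cV cVx cVy dVx dVy] := C.
have cp := C1fun_cont (robin_modeC1 mp); have cs := C1fun_cont (robin_modeC1 ms).
have Hx : (k1 ^+ 2 + delta) * norm2 a b c d V
   - delta * segint c d (fun y => segint a b (fun x => V (x, y) * phi x) ^+ 2)
   <= segint c d (fun y => robin_energy beta a b (fun x => V (x, y)) (fun x => Vx (x, y))).
  rewrite /norm2 -!segintZ; try cont.
  rewrite -segintB; try cont.
  apply: le_segint; rewrite /robin_energy; try cont.
  move=> y _; apply: (robin_deflated b0 ab k10 k12 k2E mp pm pN _ dk).
  by split; [move=> x; exact: dVx|cont].
have Hy : (k1' ^+ 2 + delta) * norm2 a b c d V
   - delta * segint a b (fun x => segint c d (fun y => V (x, y) * psi y) ^+ 2)
   <= segint a b (fun x => robin_energy beta c d (fun y => V (x, y)) (fun y => Vy (x, y))).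
  rewrite /norm2 -(@segint_swap _ a b c d (fun p => V p ^+ 2)) /=; last cont.
  rewrite -!segintZ; try cont.
  rewrite -segintB; try cont.
  apply: le_segint; rewrite /robin_energy; try cont.
  move=> x _; apply: (robin_deflated b0 cd k10' k12' k2E' ms sm sN _ dk').
  by split; [move=> y; exact: dVy|cont].
apply: le_trans (lerD Hx Hy).
have := bessel_tensor cV cp cs pN sN.
set A := segint _ _ _; set B := segint a b _; set N := norm2 _ _ _ _ _; set D := segint _ _ _ => H.
have : 0 <= delta * (N + D ^+ 2 - (A + B)) by rewrite mulr_ge0// subr_ge0.
lra.
Qed.

End TwoDim.

(** * Monotonicity and convexity of the frequencies *)

Section Frequencies.
Context {R : realType}.
Implicit Types (b c k p q x y : R).

Lemma ler_sqrP x y : 0 < x -> 0 < y -> (x ^+ 2 <= y ^+ 2) = (x <= y).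
Proof. by move=> x0 y0; rewrite ler_pXn2r// nnegrE ltW. Qed.

Lemma ltr_sqrP x y : 0 < x -> 0 < y -> (x ^+ 2 < y ^+ 2) = (x < y).
Proof. by move=> x0 y0; rewrite ltr_pXn2r// nnegrE ltW. Qed.

(** For [c = pi / 2] and [c = pi], this is the equation of the frequencies of the first
    even and of the first odd mode on a segment of half-length [b], for the Robin
    parameter 1. *)
Definition freq_eq c b k : Prop := 0 < k /\ k * b + atan k = c.

Lemma freq_exists c b : 0 < c -> 0 < b -> exists k, freq_eq c b k.
Proof.
move=> c0 b0; pose f (x : R) := x * b + atan x.
have cb0 : 0 <= c / b by rewrite divr_ge0 ?ltW.
have cf : continuous f.
  by apply: contD; [apply: contM; [move=> x; exact: cvg_id|exact: cont_cst]|exact: continuous_atan].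
have f0 : f 0 = 0 by rewrite /f mul0r atan0 addr0.
have f1 : c <= f (c / b).
  by rewrite /f divfK ?gt_eqF// lerDl -(@atan0 R) le_atan.
have [||k] := @IVT R f 0 (c / b) c cb0.
- exact: continuous_subspaceT.
- by rewrite f0 ge_min le_max f1 ltW// orbT.
rewrite in_itv/= => /andP[k0 _] fk; exists k; split => //.
rewrite lt_neqAle k0 andbT; apply/eqP => k00.
by move: c0; rewrite -fk -k00 f0 ltxx.
Qed.

Lemma atan_gt0 x : 0 < x -> 0 < atan x.
Proof. by move=> x0; rewrite -[ltLHS](@atan0 R) lt_atan. Qed.

Lemma freq_anti c b b' k k' : 0 < b -> freq_eq c b k -> freq_eq c b' k' -> b < b' -> k' < k.
Proof.
move=> b0 [k0 kE] [k'0 k'E] bb'; rewrite ltNge; apply/negP => kk'.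
have := le_atan kk'; have : k * b < k' * b'.
  apply: (@le_lt_trans _ _ (k' * b)); last by rewrite ltr_pM2l.
  by rewrite ler_wpM2r// ltW.
lra.
Qed.

Lemma freq_lt c c' b k k' : 0 < b -> freq_eq c b k -> freq_eq c' b k' -> c < c' -> k < k'.
Proof.
move=> b0 [k0 kE] [k'0 k'E] cc'; rewrite ltNge; apply/negP => kk'.
have := le_atan kk'; have : k' * b <= k * b by rewrite ler_pM2r.
lra.
Qed.

Lemma freq_half c b k : freq_eq c b k -> b = (c - atan k) / k.
Proof. by move=> [k0 <-]; rewrite addrK mulrAC mulfV ?mul1r ?gt_eqF. Qed.

Lemma tan_atanB x y : 0 <= x -> 0 <= y -> tan (atan x - atan y) = (x - y) / (1 + x * y).
Proof.
have c0 (z : R) : cos (atan z) != 0.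
  by rewrite cos_atan invr_eq0 sqrtr_eq0 -ltNge ltr_wpDr// sqr_ge0.
by move=> x0 y0; rewrite tanD ?cosN// tanN !atanK mulrN opprK.
Qed.

(** Concavity of [g |-> atan (sqrt g)], as a comparison of its increments over
    [[p' ^+ 2, p ^+ 2]] and over [[q' ^+ 2, q ^+ 2]]. The tangents of these increments
    are [(p - p') / (1 + p * p')] and [(q - q') / (1 + q * q')]. *)
Lemma atan_sqrt_concave p p' q q' : 0 <= p' -> p' <= p -> 0 <= q' -> q' <= q -> p <= q -> p' <= q' ->
  p ^+ 2 - p' ^+ 2 = q ^+ 2 - q' ^+ 2 ->
  atan q - atan q' <= atan p - atan p'.
Proof.
move=> p'0 pp q'0 qq pq pq' E.
have p0 := le_trans p'0 pp; have q0 := le_trans q'0 qq.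
have rng (x y : R) : 0 <= y -> y <= x -> atan x - atan y \in `](- (pi / 2)), (pi / 2)[.
  move=> y0 yx; have := le_atan yx; have := @atan_ltpi2 R x; have := le_atan y0.
  rewrite atan0 in_itv/= => h1 h2 h3.
  have := @pi_gt0 R => h4; apply/andP; split; lra.
rewrite leNgt -(ltr_tan (rng p p' p'0 pp) (rng q q' q'0 qq)) -leNgt !tan_atanB//.
have [pq0|pq0] := leP (p + p') 0.
  have -> : p = 0 by lra.
  have -> : p' = 0 by lra.
  have : (q - q') * (q + q') = 0 by move: E; nra.
  move/eqP; rewrite mulf_eq0 => /orP[/eqP ->|/eqP q00]; first by rewrite subrr !mul0r.
  have -> : q = q' by lra.
  by rewrite !subrr !mul0r.
have h : q - q' <= p - p'.
  rewrite -(@ler_pM2r _ (p + p'))//.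
  have : (q - q') * (p + p') <= (q - q') * (q + q') by rewrite ler_wpM2l ?subr_ge0// lerD.
  move: E; nra.
apply: ler_pM => //; first by rewrite subr_ge0.
  by rewrite invr_ge0 addr_ge0// mulr_ge0.
rewrite lef_pV2 ?posrE ?ltr_wpDr// ?mulr_ge0//.
by rewrite lerD2l ler_pM.
Qed.

(** Let [d] be the gap at [b], and consider, for [x > 0] and [y = sqrt (x ^+ 2 + d)],
    the half-lengths [(pi / 2 - atan x) / x] and [(pi - atan y) / y] for which [x] is
    the first frequency and [y] the second one. The quotient of the latter by the former
    is 1 for [x = p], and it strictly increases with [x], as a product of [x / y] and of
    [(pi - atan y) / (pi / 2 - atan x)], which increases by concavity. At [x = p' < p]
    it is thus less than 1, so that the second frequency [q'] is less than [y]. *)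
Lemma gap_decreasing b b' p q p' q' : 0 < b -> b < b' ->
  freq_eq (pi / 2) b p -> freq_eq pi b q -> freq_eq (pi / 2) b' p' -> freq_eq pi b' q' ->
  q' ^+ 2 - p' ^+ 2 < q ^+ 2 - p ^+ 2.
Proof.
move=> b0 bb' hp hq hp' hq'.
have b'0 := lt_trans b0 bb'.
have pip : pi / 2 < pi :> R by have := @pi_gt0 R; lra.
have pp := freq_anti b0 hp hp' bb'.
have pq := freq_lt b0 hp hq pip.
have [p0 pE] := hp; have [q0 qE] := hq; have [p'0 p'E] := hp'; have [q'0 q'E] := hq'.
rewrite ltNge; apply/negP => H.
pose d := q ^+ 2 - p ^+ 2.
have d0 : 0 < d by rewrite /d subr_gt0 ltr_sqrP.
(* By contradiction: [r] is the value of [y] at [x = p'], and [H] means that [r <= q']. *)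
pose r := Num.sqrt (p' ^+ 2 + d).
have r2 : r ^+ 2 = p' ^+ 2 + d by rewrite sqr_sqrtr// addr_ge0 ?sqr_ge0// ltW.
have r0 : 0 < r by rewrite sqrtr_gt0 ltr_wpDl// sqr_ge0.
have rq' : r <= q' by rewrite -ler_sqrP// r2 /d; lra.
have rq : r < q.
  rewrite -ltr_sqrP// r2 /d.
  have : p' ^+ 2 < p ^+ 2 by rewrite ltr_sqrP.
  lra.
have p'r : p' < r by rewrite -ltr_sqrP// r2 ltrDl.
have cv : atan q - atan r <= atan p - atan p'.
  by apply: atan_sqrt_concave; rewrite ?r2 ?/d; lra.
have ap := atan_ltpi2 p; have ap' := atan_ltpi2 p'.
have apq := @lt_atan R _ _ pq; have app := @lt_atan R _ _ pp; have aprq := @lt_atan R _ _ rq.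
have ap'0 := atan_gt0 p'0; have aq2 := atan_ltpi2 q.
have h1 : r * b' + atan r <= pi.
  by rewrite -q'E lerD ?le_atan// ler_wpM2r// ltW.
have h2 : r * (pi / 2 - atan p') <= p' * (pi - atan r).
  have -> : pi / 2 - atan p' = p' * b' by rewrite -p'E addrK.
  by rewrite mulrCA ler_pM2l// lerBrDr.
have h3 : q * (pi / 2 - atan p) = p * (pi - atan q).
  have -> : pi / 2 - atan p = p * b by rewrite -pE addrK.
  have -> : pi - atan q = q * b by rewrite -qE addrK.
  by rewrite mulrCA.
have h4 : (pi - atan r) * (pi / 2 - atan p) <= (pi - atan q) * (pi / 2 - atan p').
  rewrite -subr_ge0.
  have e1 : 0 <= (pi / 2) * ((atan p - atan p') - (atan q - atan r)).
    by rewrite mulr_ge0 ?subr_ge0// ltW// divr_gt0 ?pi_gt0.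
  have e2 : 0 <= atan p * (atan q - atan r) by rewrite mulr_ge0 ?subr_ge0 ?ltW// atan_gt0.
  have e3 : 0 <= (pi / 2 - atan q) * (atan p - atan p') by rewrite mulr_ge0 ?subr_ge0 ?ltW.
  have -> : (pi - atan q) * (pi / 2 - atan p') - (pi - atan r) * (pi / 2 - atan p) =
   (pi / 2) * ((atan p - atan p') - (atan q - atan r)) + atan p * (atan q - atan r)
   + (pi / 2 - atan q) * (atan p - atan p').
    by field.
  by rewrite !addr_ge0.
have h5 : p' * q < p * r.
  rewrite -ltr_sqrP ?mulr_gt0// !exprMn r2.
  have -> : q ^+ 2 = p ^+ 2 + d by rewrite /d; ring.
  rewrite -subr_gt0 (_ : _ - _ = (p ^+ 2 - p' ^+ 2) * d); last by ring.
  by rewrite mulr_gt0// subr_gt0 ltr_sqrP.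
(* With [h3], the inequalities [h2] and [h4] bound [p * r] by [p' * q], against [h5]. *)
have A : 0 < pi / 2 - atan p by rewrite subr_gt0.
have B : 0 < pi / 2 - atan p' by rewrite subr_gt0.
have C : 0 < pi - atan q by rewrite subr_gt0 (lt_trans aq2).
have : p * r * ((pi / 2 - atan p) * (pi / 2 - atan p')) <=
       p' * q * ((pi / 2 - atan p) * (pi / 2 - atan p')).
  have s1 : p * r * ((pi / 2 - atan p) * (pi / 2 - atan p')) <=
     p * (pi / 2 - atan p) * (p' * (pi - atan r)).
    have -> : p * r * ((pi / 2 - atan p) * (pi / 2 - atan p')) =
      p * (pi / 2 - atan p) * (r * (pi / 2 - atan p')) by ring.
    by rewrite ler_wpM2l// mulr_ge0// ltW.
  apply: (le_trans s1).
  have -> : p * (pi / 2 - atan p) * (p' * (pi - atan r)) =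
    p * p' * ((pi - atan r) * (pi / 2 - atan p)) by ring.
  have -> : p' * q * ((pi / 2 - atan p) * (pi / 2 - atan p')) =
    p * p' * ((pi - atan q) * (pi / 2 - atan p')).
    rewrite -[RHS]mulrA [in RHS]mulrCA mulrA [p * _ in RHS]mulrA -h3; ring.
  by rewrite ler_wpM2l// mulr_ge0// ltW.
by apply/negP; rewrite -ltNge ltr_pM2r// mulr_gt0.
Qed.

(** Convexity of [p ^+ 2] as a function of the half-length [b]. The inverse function
    maps [g = p ^+ 2] to [(pi / 2 - atan (sqrt g)) / sqrt g], the product of two
    positive, decreasing and convex functions of [g]: it is decreasing and convex too,
    and so is its inverse. *)
Lemma freq1_convex s b b' p p' k : 0 < b -> 0 < b' -> b + b' = 2 * s ->
  freq_eq (pi / 2) b p -> freq_eq (pi / 2) b' p' -> freq_eq (pi / 2) s k ->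
  2 * k ^+ 2 <= p ^+ 2 + p' ^+ 2.
Proof.
wlog pp : b b' p p' / p' <= p => [H|].
  move=> b0 b'0 bs hp hp' hk; have [pp|/ltW pp] := leP p' p; first exact: (H b b').
  by rewrite addrC; apply: (H b' b) => //; rewrite addrC.
move=> b0 b'0 bs hp hp' hk.
have [p0 pE] := hp; have [p'0 p'E] := hp'; have [k0 kE] := hk.
have pi0 := @pi_gt0 R.
pose m2 := (p ^+ 2 + p' ^+ 2) / 2; pose m := Num.sqrt m2.
have m20 : 0 < m2 by rewrite divr_gt0// addr_gt0// exprn_gt0.
have mE : m ^+ 2 = m2 by rewrite sqr_sqrtr// ltW.
have m0 : 0 < m by rewrite sqrtr_gt0.
have pp2 : p' ^+ 2 <= p ^+ 2 by rewrite ler_sqrP.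
have mp : m <= p by rewrite -ler_sqrP// mE /m2; lra.
have pm : p' <= m by rewrite -ler_sqrP// mE /m2; lra.
have cv : atan p - atan m <= atan m - atan p'.
  by apply: atan_sqrt_concave; rewrite ?mE ?/m2; lra.
have hm : (p + p') / 2 <= m.
  rewrite -ler_sqrP ?divr_gt0 ?addr_gt0// mE /m2.
  have := sqr_ge0 (p - p'); nra.
have iv : m^-1 <= (p^-1 + p'^-1) / 2.
  have : m^-1 <= ((p + p') / 2)^-1 by rewrite lef_pV2 ?posrE ?divr_gt0 ?addr_gt0.
  move/le_trans; apply.
  rewrite invf_div -subr_ge0.
  have -> : (p^-1 + p'^-1) / 2 - 2 / (p + p') = (p - p') ^+ 2 / (2 * p * p' * (p + p')).
    by field; rewrite !gt_eqF// addr_gt0.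
  by rewrite divr_ge0 ?sqr_ge0// !mulr_ge0// ?addr_ge0// ltW.
have am : pi / 2 - atan m <= ((pi / 2 - atan p) + (pi / 2 - atan p')) / 2 by lra.
have ap := atan_ltpi2 p; have ap' := atan_ltpi2 p'; have amm := atan_ltpi2 m.
have app := le_atan pp.
have ms : (pi / 2 - atan m) / m <= s.
  have -> : s = (b + b') / 2 by rewrite bs; field.
  rewrite (freq_half hp) (freq_half hp').
  apply: (@le_trans _ _ (((pi / 2 - atan p) + (pi / 2 - atan p')) / 2 * ((p^-1 + p'^-1) / 2))).
    apply: ler_pM => //; first by rewrite subr_ge0 ltW.
    by rewrite invr_ge0 ltW.
  have ivp : p^-1 <= p'^-1 by rewrite lef_pV2.
  have : 0 <= (atan p - atan p') * (p'^-1 - p^-1) by rewrite mulr_ge0// subr_ge0.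
  move: (atan p) (atan p') (p^-1) (p'^-1) => u u' v v'; lra.
suff km : k <= m.
  have : k ^+ 2 <= m ^+ 2 by rewrite ler_sqrP.
  by rewrite mE /m2; lra.
rewrite leNgt; apply/negP => mk.
have := @lt_atan R _ _ mk; have : m * s < k * s.
  by rewrite ltr_pM2r//; move: bs b0 b'0; lra.
by move: ms; rewrite ler_pdivrMr// [s * m]mulrC; lra.
Qed.

End Frequencies.

(** * C^1 functions in rotated coordinates *)

Section Plane.
Context {R : realType}.
Implicit Types (t beta : R) (f g phi : R * R -> R) (Q : rectangle R).

Lemma C1_cont f : C1 f -> continuous f.
Proof. by move=> [df _] x; exact: differentiable_continuous. Qed.

Lemma diff_partial f (p : R * R) (u v : R) : differentiable f p ->
  'd f p (u, v) = u * partial false f p + v * partial true f p.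
Proof.
move=> df; rewrite /partial !deriveE// /dir.
rewrite (_ : (u, v) = u *: (1, 0) + v *: (0, 1)).
  by rewrite linearD !linearZ.
by congr pair; rewrite /= /GRing.scale/= ?mulr1 ?mulr0 ?addr0 ?add0r.
Qed.

Lemma is_derive_line f (g : R -> R * R) (p0 : R * R) (u v s : R) :
  (forall p, differentiable f p) -> (forall s, g s = (p0.1 + u * s, p0.2 + v * s)) ->
  is_derive s 1 (fun s => f (g s)) (u * partial false f (g s) + v * partial true f (g s)).
Proof.
move=> df /funext gE.
have dg : is_diff s g (fun h => (u * h, v * h)).
  have d1 (c w : R) : is_diff s (fun s => c + w * s) (fun h => w * h).
    have := @is_diffD R R R (cst c) (fun s => w * s) 0 (fun h => w * h) s (is_diff_cst c s).
    rewrite add0r; apply.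
  by rewrite gE; exact: is_diff_pair.
have [dgs dgE] := dg.
have dfg : differentiable (f \o g) s by apply: differentiable_comp.
apply: DeriveDef; first exact: diff_derivable.
rewrite deriveE// diff_comp//= dgE /= !mulr1.
exact: diff_partial.
Qed.

(** Chain rule along the lines parallel to the rotated axes. *)
Lemma C1_plane f t : C1 f ->
  C1plane (fun p => f (rot t p))
    (fun p => cos t * partial false f (rot t p) + sin t * partial true f (rot t p))
    (fun p => - sin t * partial false f (rot t p) + cos t * partial true f (rot t p)).
Proof.
move=> f1; have cf := C1_cont f1; have cr := @cont_rot R t.
have [df cpf] := f1; have c0 := cpf false; have c1 := cpf true.
split; try cont.
- move=> x y; apply: (is_derive_line (p0 := (- (sin t * y), cos t * y))) => // s.
  by rewrite /rot /=; congr pair; ring.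
- move=> x y; apply: (is_derive_line (p0 := (cos t * x, sin t * x))) => // s.
  by rewrite /rot /=; congr pair; ring.
Qed.

Lemma segint_rot Q f : continuous f ->
  \int[leb2 R]_(p in domain Q) f p =
  segint (rbottom Q) (rtop Q) (fun y => segint (rleft Q) (rright Q) (fun x => f (rot (rangle Q) (x, y)))).
Proof.
move=> cf; have cr := @cont_rot R (rangle Q).
rewrite (integral_domain Q cf).2 (box_integral21 _ _ _ _ (f := fun p => f (rot (rangle Q) p)))//.
cont.
Qed.

Definition c1data f : h1data := H1Data f (fun i => partial i f) f.

Lemma boundary_integralE Q f :
  boundary_integral Q f =
   segint (rleft Q) (rright Q) (fun s => f (rot (rangle Q) (s, rbottom Q)))
   + segint (rleft Q) (rright Q) (fun s => f (rot (rangle Q) (s, rtop Q)))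
   + segint (rbottom Q) (rtop Q) (fun s => f (rot (rangle Q) (rleft Q, s)))
   + segint (rbottom Q) (rtop Q) (fun s => f (rot (rangle Q) (rright Q, s))).
Proof.
rewrite /boundary_integral !big_bool /= /side_range /side /= -!segintE.
set A := segint _ _ _; set B := segint _ _ _; set C := segint _ _ _; set D := segint _ _ _.
by rewrite [A + B]addrC [C + D]addrC !addrA.
Qed.

(** A rotation preserves the length of the gradient. *)
Lemma robin_form_plane Q beta f : C1 f ->
  \int[leb2 R]_(x in domain Q) (partial false f x ^+ 2 + partial true f x ^+ 2)
   + beta * boundary_integral Q (fun x => f x ^+ 2) =
  plane_energy beta (rleft Q) (rright Q) (rbottom Q) (rtop Q) (fun p => f (rot (rangle Q) p))
    (fun p => cos (rangle Q) * partial false f (rot (rangle Q) p)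
            + sin (rangle Q) * partial true f (rot (rangle Q) p))
    (fun p => - sin (rangle Q) * partial false f (rot (rangle Q) p)
            + cos (rangle Q) * partial true f (rot (rangle Q) p)).
Proof.
move=> [_ cp]; have c0 := cp false; have c1 := cp true.
rewrite segint_rot; last cont.
rewrite boundary_integralE /plane_energy; apply: (congr1 (fun z => z + _)).
apply: eq_segint => y _; apply: eq_segint => x _.
set A := partial _ _ _; set B := partial _ _ _.
have e := cos2Dsin2 (rangle Q).
transitivity ((cos (rangle Q) ^+ 2 + sin (rangle Q) ^+ 2) * (A ^+ 2 + B ^+ 2)).
  by rewrite e mul1r.
ring.
Qed.

Lemma parts_vanishing (a b c d : R) V Vx Vy W Wx Wy : a < b -> c < d ->
  C1plane V Vx Vy -> C1plane W Wx Wy ->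
  (forall y, W (a, y) = 0 /\ W (b, y) = 0) -> (forall x, W (x, c) = 0 /\ W (x, d) = 0) ->
  segint c d (fun y => segint a b (fun x => V (x, y) * Wx (x, y) + Vx (x, y) * W (x, y))) = 0 /\
  segint c d (fun y => segint a b (fun x => V (x, y) * Wy (x, y) + Vy (x, y) * W (x, y))) = 0.
Proof.
move=> ab cd [cV cVx cVy dVx dVy] [cW cWx cWy dWx dWy] Wv Wh.
have seg0 (u v : R) : segint u v (fun=> 0 : R) = 0 by rewrite segintE Rintegral_cst// mul0r.
split.
  rewrite -[RHS](seg0 c d); apply: eq_segint => y _.
  transitivity (V (b, y) * W (b, y) - V (a, y) * W (a, y)).
    apply: (@segint_FTC _ a b (fun x => V (x, y) * W (x, y))) => //; first cont.
    move=> x; have d1 := dVx x y; have d2 := dWx x y.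
    by apply: is_derive_eq; rewrite /GRing.scale/=; ring.
  by have [-> ->] := Wv y; rewrite !mulr0 subrr.
rewrite -(@segint_swap _ a b c d (fun p => V p * Wy p + Vy p * W p)) /=; last cont.
rewrite -[RHS](seg0 a b); apply: eq_segint => x _.
transitivity (V (x, d) * W (x, d) - V (x, c) * W (x, c)).
  apply: (@segint_FTC _ c d (fun y => V (x, y) * W (x, y))) => //; first cont.
  move=> y; have d1 := dVy x y; have d2 := dWy x y.
  by apply: is_derive_eq; rewrite /GRing.scale/=; ring.
by have [-> ->] := Wh x; rewrite !mulr0 subrr.
Qed.

(** In the unrotated coordinates, a partial derivative is a combination with constant
    coefficients of the derivatives along the sides, and the test function vanishes on
    the boundary of the box. *)
Lemma C1_weak_partial Q i f : C1 f -> weak_partial (domain Q) i f (partial i f).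
Proof.
move=> f1 phi [phi1 [K [_ KD K0]]].
have cf := C1_cont f1; have cphi := C1_cont phi1.
have cfi := f1.2 i; have cpi := phi1.2 i.
have out p : ~ box (rleft Q) (rright Q) (rbottom Q) (rtop Q) p -> phi (rot (rangle Q) p) = 0.
  move=> bp; apply: K0 => /KD; rewrite domainE /= rotateK; exact: bp.
have vv y : phi (rot (rangle Q) (rleft Q, y)) = 0 /\ phi (rot (rangle Q) (rright Q, y)) = 0.
  by split; apply: out => -[/=]; rewrite in_itv/= ltxx// andbF.
have hh x : phi (rot (rangle Q) (x, rbottom Q)) = 0 /\ phi (rot (rangle Q) (x, rtop Q)) = 0.
  by split; apply: out => -[_ /=]; rewrite in_itv/= ltxx// andbF.
have [d0 d1] := parts_vanishing (rlr Q) (rbt Q) (C1_plane (rangle Q) f1) (C1_plane (rangle Q) phi1) vv hh.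
have cM1 : continuous (fun p => f p * partial i phi p) by cont.
have cM2 : continuous (fun p => partial i f p * phi p) by cont.
apply/eqP; rewrite -subr_eq0 opprK; apply/eqP.
rewrite !segint_rot//.
have [[c0 c1] [e0 e1]] := ((f1.2 false, f1.2 true), (phi1.2 false, phi1.2 true)).
have cr := @cont_rot R (rangle Q).
rewrite -segintD; try cont.
rewrite (@eq_segint _ _ _ _ (fun y => segint (rleft Q) (rright Q) (fun x =>
   f (rot (rangle Q) (x, y)) * partial i phi (rot (rangle Q) (x, y))
   + partial i f (rot (rangle Q) (x, y)) * phi (rot (rangle Q) (x, y))))); last first.
  by move=> y _; rewrite segintD; try cont.
have e := cos2Dsin2 (rangle Q).
pose al := if i then sin (rangle Q) else cos (rangle Q).
pose be := if i then cos (rangle Q) else - sin (rangle Q).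
have E : al * 0 + be * 0 = 0 by rewrite !mulr0 addr0.
rewrite -[X in al * X]d0 -[X in be * X]d1 in E; rewrite -[RHS]E.
rewrite -!segintZ; try cont.
rewrite -segintD; try cont.
apply: eq_segint => y _.
rewrite -!segintZ; try cont.
rewrite -segintD; try cont.
apply: eq_segint => x _.
set F := f _; set P := phi _.
set fF := partial false f _; set fT := partial true f _.
set pF := partial false phi _; set pT := partial true phi _.
rewrite /al /be; clear -e; case: i => /=.
  transitivity ((cos (rangle Q) ^+ 2 + sin (rangle Q) ^+ 2) * (F * pT + fT * P)).
    by rewrite e mul1r.
  ring.
transitivity ((cos (rangle Q) ^+ 2 + sin (rangle Q) ^+ 2) * (F * pF + fF * P)).
  by rewrite e mul1r.
ring.
Qed.

End Plane.

(** * Limits in L^2 *)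

Section L2Limits.
Context {R : realType} {d : measure_display} {T : measurableType d}.
Variable mu : {measure set T -> \bar R}.
Variable D : set T.
Hypothesis mD : measurable D.
Implicit Types (f g h : T -> R) (v w : nat -> T -> R) (c : R).

Lemma L2_sqr f : L2 mu D f -> mu.-integrable D (EFin \o (fun x => f x ^+ 2)).
Proof.
move=> [mf fi]; apply/integrableP; split.
  by apply/measurable_EFinP; apply: measurable_funX.
by under eq_integral => x _ do rewrite /= ger0_norm ?sqr_ge0//.
Qed.

Lemma integrable_L2 f : measurable_fun D f ->
  mu.-integrable D (EFin \o (fun x => f x ^+ 2)) -> L2 mu D f.
Proof. by move=> mf i; split => //; exact: (integrable_lty mD i). Qed.

Lemma L2_mul f g : L2 mu D f -> L2 mu D g -> mu.-integrable D (EFin \o (fun x => f x * g x)).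
Proof.
move=> Lf Lg; have [mf _] := Lf; have [mg _] := Lg.
apply: (le_integrable mD _ _ (integrableD mD (L2_sqr Lf) (L2_sqr Lg))).
  by apply/measurable_EFinP; exact: measurable_funM.
move=> x _ /=; rewrite lee_fin [leRHS]ger0_norm ?addr_ge0 ?sqr_ge0//.
rewrite ler_norml; apply/andP; split.
  by have := sqr_ge0 (f x + g x); have := sqr_ge0 (f x); have := sqr_ge0 (g x); nra.
by have := sqr_ge0 (f x - g x); have := sqr_ge0 (f x); have := sqr_ge0 (g x); nra.
Qed.

Lemma L2Z c f : L2 mu D f -> L2 mu D (fun x => c * f x).
Proof.
move=> Lf; have [mf _] := Lf; apply: integrable_L2.
  by apply: measurable_funM.
apply: eq_integrable (integrableZl mD (c ^+ 2) (L2_sqr Lf)) => // x _ /=.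
by rewrite -EFinM exprMn.
Qed.

Lemma L2D f g : L2 mu D f -> L2 mu D g -> L2 mu D (fun x => f x + g x).
Proof.
move=> Lf Lg; have [mf _] := Lf; have [mg _] := Lg; apply: integrable_L2.
  exact: measurable_funD.
have i := integrableD mD (integrableD mD (L2_sqr Lf) (L2_sqr Lg))
  (integrableZl mD 2 (L2_mul Lf Lg)).
apply: eq_integrable i => // x _ /=.
by rewrite -!EFinM -!EFinD; congr EFin; ring.
Qed.

Lemma L2B f g : L2 mu D f -> L2 mu D g -> L2 mu D (fun x => f x - g x).
Proof.
move=> Lf Lg; have := L2D Lf (L2Z (-1) Lg).
by under [X in L2 _ _ X -> _]eq_fun do rewrite mulN1r.
Qed.

Lemma L2_0 : L2 mu D (fun=> 0).
Proof.
split; first exact: measurable_cst.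
by under eq_integral do rewrite expr0n/=; rewrite integral0.
Qed.

Definition dist2 f g : R := \int[mu]_(x in D) ((f x - g x) ^+ 2).

Lemma L2_cvgP v f : (forall n, L2 mu D (v n)) -> L2 mu D f ->
  L2_cvg mu D v f <-> (fun n => dist2 (v n) f) @ \oo --> (0 : R).
Proof.
move=> Lv Lf; rewrite /L2_cvg.
have -> : (fun n => (\int[mu]_(x in D) ((v n x - f x) ^+ 2)%:E)%E) =
          (fun n => (dist2 (v n) f)%:E).
  apply/funext => n; rewrite /dist2 /Rintegral fineK//.
  exact: (integrable_fin_num mD (L2_sqr (L2B (Lv n) Lf))).
split; first by move=> /fine_cvgP[].
by move=> h; apply/fine_cvgP; split => //; exact: nearW.
Qed.

Lemma dist2_ge0 f g : 0 <= dist2 f g.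
Proof. by apply: Rintegral_ge0 => x _; exact: sqr_ge0. Qed.

Lemma L2_cvgD v w f g : (forall n, L2 mu D (v n)) -> (forall n, L2 mu D (w n)) ->
  L2 mu D f -> L2 mu D g -> L2_cvg mu D v f -> L2_cvg mu D w g ->
  L2_cvg mu D (fun n x => v n x + w n x) (fun x => f x + g x).
Proof.
move=> Lv Lw Lf Lg /(L2_cvgP Lv Lf) cv /(L2_cvgP Lw Lg) cw.
apply/L2_cvgP; [by move=> n; exact: L2D|exact: L2D|].
have c2 : (fun n => 2 * dist2 (v n) f + 2 * dist2 (w n) g) @ \oo --> (0 : R).
  rewrite -[X in _ --> X](addr0 0) -[X in _ --> X + _](mulr0 2) -[X in _ --> _ + X](mulr0 2).
  by apply: cvgD; apply: cvgM => //; exact: cvg_cst.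
apply: (@squeeze_cvgr _ _ _ R (fun=> 0) _ _ _ 0 (cvg_cst _) c2).
apply: nearW => n; rewrite dist2_ge0/= /dist2.
have i1 := L2_sqr (L2B (Lv n) Lf); have i2 := L2_sqr (L2B (Lw n) Lg).
rewrite -!RintegralZl// -RintegralD//; last 2 first.
- exact: (integrableZl mD 2 i1).
- exact: (integrableZl mD 2 i2).
apply: le_Rintegral => //.
- exact: (L2_sqr (L2B (L2D (Lv n) (Lw n)) (L2D Lf Lg))).
- exact: (integrableD mD (integrableZl mD 2 i1) (integrableZl mD 2 i2)).
move=> x _; have := sqr_ge0 ((v n x - f x) - (w n x - g x)); nra.
Qed.

Lemma L2_cvgZ c v f : (forall n, L2 mu D (v n)) -> L2 mu D f -> L2_cvg mu D v f ->
  L2_cvg mu D (fun n x => c * v n x) (fun x => c * f x).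
Proof.
move=> Lv Lf /(L2_cvgP Lv Lf) cv.
apply/L2_cvgP; [by move=> n; exact: L2Z|exact: L2Z|].
have -> : (fun n => dist2 (fun x => c * v n x) (fun x => c * f x)) = (fun n => c ^+ 2 * dist2 (v n) f).
  apply/funext => n; rewrite /dist2 -RintegralZl//; last exact: L2_sqr (L2B (Lv n) Lf).
  by apply: eq_Rintegral => x _; ring.
by rewrite -[X in _ --> X](mulr0 (c ^+ 2)); apply: cvgM => //; exact: cvg_cst.
Qed.

Lemma L2_cvg_cst f : L2_cvg mu D (fun=> f) f.
Proof.
rewrite /L2_cvg (_ : (fun=> _) = cst 0%E); first exact: cvg_cst.
apply/funext => n; under eq_integral do rewrite subrr expr0n/=.
by rewrite integral0.
Qed.

Lemma L2_sum (I : Type) (s : seq I) (c : I -> R) (f : I -> T -> R) :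
  (forall i, L2 mu D (f i)) -> L2 mu D (fun x => \sum_(i <- s) c i * f i x).
Proof.
move=> Lf; elim: s => [|i s IH].
  by under eq_fun do rewrite big_nil; exact: L2_0.
by under eq_fun do rewrite big_cons; apply: L2D => //; exact: L2Z.
Qed.

Lemma L2_cvg_sum (I : Type) (s : seq I) (c : I -> R) (v : I -> nat -> T -> R) (f : I -> T -> R) :
  (forall i n, L2 mu D (v i n)) -> (forall i, L2 mu D (f i)) ->
  (forall i, L2_cvg mu D (v i) (f i)) ->
  L2_cvg mu D (fun n x => \sum_(i <- s) c i * v i n x) (fun x => \sum_(i <- s) c i * f i x).
Proof.
move=> Lv Lf cv; elim: s => [|i s IH].
  rewrite (_ : (fun x => _) = (fun=> 0)); last by apply/funext => x; rewrite big_nil.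
  rewrite (_ : (fun n x => _) = (fun=> fun=> 0)); first exact: L2_cvg_cst.
  by apply/funext => n; apply/funext => x; rewrite big_nil.
rewrite (_ : (fun x => _) = (fun x => c i * f i x + \sum_(i <- s) c i * f i x)); last first.
  by apply/funext => x; rewrite big_cons.
rewrite (_ : (fun n x => _) = (fun n x => c i * v i n x + \sum_(i <- s) c i * v i n x)); last first.
  by apply/funext => n; apply/funext => x; rewrite big_cons.
apply: L2_cvgD => //.
- by move=> n; exact: L2Z.
- by move=> n; exact: L2_sum.
- exact: L2Z.
- exact: L2_sum.
- exact: L2_cvgZ.
Qed.

(** This is how quadratic and bilinear quantities vary: [e n] stands for the squared
    distance of the [n]-th function to its limit, and the bound comes from
    [2 * u * v <= t * u ^+ 2 + v ^+ 2 / t]. *)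
Lemma cvg_of_bound (a e : nat -> R) (l K : R) : 0 <= K -> (forall n, 0 <= e n) ->
  (forall n t, 0 < t -> `|l - a n| <= t * K + (1 + t^-1) * e n) ->
  e @ \oo --> (0 : R) -> a @ \oo --> l.
Proof.
move=> K0 e0 H /cvgrPdist_lt ec; apply/cvgrPdist_le => eta eta0.
have K1 : 0 < 2 * (K + 1) by rewrite mulr_gt0// ltr_wpDl.
pose t := eta / (2 * (K + 1)).
have t0 : 0 < t by rewrite divr_gt0.
have t1 : 0 < 1 + t^-1 by rewrite addr_gt0// invr_gt0.
have z0 : 0 < eta / 2 / (1 + t^-1) by rewrite divr_gt0// divr_gt0.
apply: filterS (ec _ z0) => n; rewrite sub0r normrN ger0_norm// => en.
apply: (le_trans (H n t t0)).
rewrite [leRHS]splitr lerD//.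
  rewrite /t mulrAC ler_pdivrMr// mulrA divfK// ler_wpM2l ?ltW//.
  by rewrite ltrDl.
by rewrite mulrC -ler_pdivlMr// ltW.
Qed.

Lemma L2_cvg_norm v f : (forall n, L2 mu D (v n)) -> L2 mu D f -> L2_cvg mu D v f ->
  (fun n => \int[mu]_(x in D) (v n x ^+ 2)) @ \oo --> \int[mu]_(x in D) (f x ^+ 2).
Proof.
move=> Lv Lf /(L2_cvgP Lv Lf); apply: (@cvg_of_bound _ _ _ (\int[mu]_(x in D) (f x ^+ 2))).
- by apply: Rintegral_ge0 => x _; exact: sqr_ge0.
- by move=> n; exact: dist2_ge0.
move=> n t t0.
have i1 := L2_sqr Lf; have i2 := L2_sqr (Lv n); have i3 := L2_sqr (L2B (Lv n) Lf).
rewrite -RintegralB//; apply: (le_trans (le_normr_Rintegral mD (integrableB mD i1 i2))).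
rewrite /dist2 -!RintegralZl// -RintegralD//; last 2 first.
- exact: (integrableZl mD t i1).
- exact: (integrableZl mD (1 + t^-1) i3).
apply: le_Rintegral => //.
- by apply: (integrable_norm (f := fun x => f x ^+ 2 - v n x ^+ 2)); exact: (integrableB mD i1 i2).
- exact: (integrableD mD (integrableZl mD t i1) (integrableZl mD (1 + t^-1) i3)).
move=> x _; rewrite mulrDl mul1r.
have : 0 <= t * (f x + t^-1 * (v n x - f x)) ^+ 2 by rewrite mulr_ge0 ?sqr_ge0// ltW.
have : 0 <= t * (f x - t^-1 * (v n x - f x)) ^+ 2 by rewrite mulr_ge0 ?sqr_ge0// ltW.
have -> : t * (f x + t^-1 * (v n x - f x)) ^+ 2 =
  t * f x ^+ 2 + 2 * f x * (v n x - f x) + t^-1 * (v n x - f x) ^+ 2 by field; rewrite gt_eqF.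
have -> : t * (f x - t^-1 * (v n x - f x)) ^+ 2 =
  t * f x ^+ 2 - 2 * f x * (v n x - f x) + t^-1 * (v n x - f x) ^+ 2 by field; rewrite gt_eqF.
move=> h1 h2; have := sqr_ge0 (v n x - f x) => h3.
have ti : 0 < t^-1 by rewrite invr_gt0.
rewrite ler_norml; apply/andP; split; move: h1 h2 h3; set P := t^-1 * _; set Q := t * _; lra.
Qed.

Lemma L2_cvg_dot v f g : (forall n, L2 mu D (v n)) -> L2 mu D f -> L2 mu D g ->
  L2_cvg mu D v f ->
  (fun n => \int[mu]_(x in D) (v n x * g x)) @ \oo --> \int[mu]_(x in D) (f x * g x).
Proof.
move=> Lv Lf Lg /(L2_cvgP Lv Lf); apply: (@cvg_of_bound _ _ _ (\int[mu]_(x in D) (g x ^+ 2))).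
- by apply: Rintegral_ge0 => x _; exact: sqr_ge0.
- by move=> n; exact: dist2_ge0.
move=> n t t0.
have i0 := L2_sqr Lg; have i1 := L2_mul Lf Lg; have i2 := L2_mul (Lv n) Lg.
have i3 := L2_sqr (L2B (Lv n) Lf).
rewrite -RintegralB//; apply: (le_trans (le_normr_Rintegral mD (integrableB mD i1 i2))).
rewrite /dist2 -!RintegralZl// -RintegralD//; last 2 first.
- exact: (integrableZl mD t i0).
- exact: (integrableZl mD (1 + t^-1) i3).
apply: le_Rintegral => //.
- by apply: (integrable_norm (f := fun x => f x * g x - v n x * g x)); exact: (integrableB mD i1 i2).
- exact: (integrableD mD (integrableZl mD t i0) (integrableZl mD (1 + t^-1) i3)).
move=> x _; rewrite mulrDl mul1r.
have : 0 <= t * (g x + t^-1 * (v n x - f x)) ^+ 2 by rewrite mulr_ge0 ?sqr_ge0// ltW.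
have : 0 <= t * (g x - t^-1 * (v n x - f x)) ^+ 2 by rewrite mulr_ge0 ?sqr_ge0// ltW.
have -> : t * (g x + t^-1 * (v n x - f x)) ^+ 2 =
  t * g x ^+ 2 + 2 * g x * (v n x - f x) + t^-1 * (v n x - f x) ^+ 2 by field; rewrite gt_eqF.
have -> : t * (g x - t^-1 * (v n x - f x)) ^+ 2 =
  t * g x ^+ 2 - 2 * g x * (v n x - f x) + t^-1 * (v n x - f x) ^+ 2 by field; rewrite gt_eqF.
move=> h1 h2; have := sqr_ge0 (v n x - f x) => h3.
have h4 : 0 <= t * g x ^+ 2 by rewrite mulr_ge0 ?sqr_ge0// ltW.
have h5 : 0 <= t^-1 * (v n x - f x) ^+ 2 by rewrite mulr_ge0 ?sqr_ge0// invr_ge0 ltW.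
rewrite -mulrBl ler_norml; apply/andP; split; move: h1 h2 h3 h4 h5; set P := t^-1 * _; set Q := t * _; nra.
Qed.

Lemma L2_norm_eq0 f : L2 mu D f ->
  \int[mu]_(x in D) (f x ^+ 2) = 0 <-> {ae mu, forall x, D x -> f x = 0}.
Proof.
move=> Lf; have [mf _] := Lf; have i := L2_sqr Lf.
have m2 : measurable_fun D (EFin \o (fun x => f x ^+ 2)).
  by apply/measurable_EFinP; exact: measurable_funX.
have [H1 H2] := ae_eq_integral_abs mu mD m2.
have E : (\int[mu]_(x in D) `|(EFin \o (fun x => f x ^+ 2)%R) x| = (\int[mu]_(x in D) (f x ^+ 2))%R%:E)%E.
  rewrite /Rintegral fineK; last exact: (integrable_fin_num mD i).
  by apply: eq_integral => x _; rewrite /= ger0_norm ?sqr_ge0.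
split=> [z|ae].
  have := H1 _; rewrite E z => /(_ erefl); apply: filterS => x /= h Dx.
  by have /eqP := h Dx; rewrite eqe sqrf_eq0 => /eqP.
have : (\int[mu]_(x in D) `|(EFin \o (fun x => f x ^+ 2)%R) x| = 0)%E.
  by apply: H2; apply: filterS ae => x h Dx /=; rewrite (h Dx) expr0n.
by rewrite E => -[].
Qed.

End L2Limits.

(** * Approximation by C^1 functions *)

Section Sobolev.
Context {R : realType}.
Implicit Types (Q : rectangle R) (beta : R) (f g : R * R -> R) (w : @h1data R).

Lemma measurable_side Q h : measurable (side_range Q h).
Proof. by rewrite /side_range; case: h; exact: measurable_itv. Qed.

Lemma cont_side Q h e : continuous (side Q h e).
Proof.
have cr := @cont_rot R (rangle Q).
by rewrite /side; case: h; apply: (cont_comp cr); apply: cont_pair; by [exact: cont_cst|exact: cont_id].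
Qed.

Lemma L2_domain Q f : continuous f -> L2 (leb2 R) (domain Q) f.
Proof.
move=> cf; apply: integrable_L2; first exact: measurable_domain.
  by apply: measurable_funTS; exact: continuous_measurable2.
by apply: (integral_domain Q _).1; exact: contX.
Qed.

Lemma L2_side Q h e f : continuous f -> L2 (leb1 R) (side_range Q h) (f \o side Q h e).
Proof.
move=> cf; have cs := @cont_side Q h e.
have cfs : continuous (f \o side Q h e) by exact: (cont_comp cf cs).
apply: integrable_L2; first exact: measurable_side.
  by apply: measurable_funTS; exact: continuous_measurable_fun.
by rewrite /side_range; case: h {cs} cfs => cfs; apply: cont_integrable; exact: contX.
Qed.

Lemma C1_H1 Q f : C1 f -> H1 Q (c1data f).
Proof.
move=> f1; have cf := C1_cont f1; have [_ cp] := f1; split.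
- exact: L2_domain.
- by move=> i; split; [exact: L2_domain (cp i)|exact: C1_weak_partial].
- by move=> h e; exact: L2_side.
- by exists (fun=> f); split => // *; exact: L2_cvg_cst.
Qed.

Lemma C1_comb (I : Type) (s : seq I) (c : I -> R) (F : I -> R * R -> R) :
  (forall i, C1 (F i)) ->
  C1 (fun x => \sum_(i <- s) c i * F i x) /\
  forall j, partial j (fun x => \sum_(i <- s) c i * F i x) =
            (fun x => \sum_(i <- s) c i * partial j (F i) x).
Proof.
move=> F1; elim: s => [|i s [[dS cS] pS]].
  have -> : (fun x => \sum_(i <- [::]) c i * F i x) = cst 0.
    by apply/funext => x; rewrite big_nil.
  have p0 j : partial j (cst 0) = cst 0 :> (R * R -> R).
    by apply/funext => x; rewrite /partial derive_cst.
  split; last by move=> j; rewrite p0; apply/funext => x; rewrite big_nil.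
  by split; [move=> x; exact: differentiable_cst|move=> j; rewrite p0; exact: cont_cst].
have -> : (fun x => \sum_(i <- i :: s) c i * F i x) =
    (c i *: F i) + (fun x => \sum_(i <- s) c i * F i x).
  by apply/funext => x; rewrite big_cons.
have [dF cF] := F1 i.
have pE j : partial j ((c i *: F i) + (fun x => \sum_(i <- s) c i * F i x)) =
    (fun x => c i * partial j (F i) x + \sum_(i <- s) c i * partial j (F i) x).
  apply/funext => x; rewrite /partial deriveD.
  - rewrite deriveZ; last exact: diff_derivable.
    by have := congr1 (fun h => h x) (pS j); rewrite /partial => ->.
  - by apply: derivableZ; exact: diff_derivable.
  - exact: diff_derivable.
split; last by move=> j; rewrite pE; apply/funext => x; rewrite big_cons.
split; first by move=> x; apply: differentiableD => //; exact: differentiableZ.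
move=> j; have := cS j; rewrite pE pS => cSj; apply: contD => //.
by apply: contM; [exact: cont_cst|].
Qed.

Lemma comb_c1data k (c : 'rV[R]_k) (F : 'I_k -> R * R -> R) : (forall i, C1 (F i)) ->
  C1 (fun x => \sum_(i < k) c 0 i * F i x) /\
  comb c (fun i => c1data (F i)) = c1data (fun x => \sum_(i < k) c 0 i * F i x).
Proof.
move=> F1; have [S1 Sp] := C1_comb (index_enum 'I_k) (fun i => c 0 i) F1.
by split => //; rewrite /comb /c1data/=; congr H1Data; apply/funext => j; rewrite Sp.
Qed.

(** What the lower bounds use of an element of [H1]: the weak derivatives only occur as
    limits of the derivatives of the approximating functions, which makes the stability
    under linear combinations immediate. *)
Definition approximable Q w : Prop :=
  [/\ L2 (leb2 R) (domain Q) (fn w),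
      forall i, L2 (leb2 R) (domain Q) (grad w i),
      forall h e, L2 (leb1 R) (side_range Q h) (trc w \o side Q h e)
    & has_trace Q w].

Lemma H1_approximable Q w : H1 Q w -> approximable Q w.
Proof. by case=> L G S t; split => // i; have [] := G i. Qed.

Lemma approximable_comb Q k (c : 'rV[R]_k) (u : 'I_k -> h1data) :
  (forall i, approximable Q (u i)) -> approximable Q (comb c u).
Proof.
move=> Hu; have mD := measurable_domain Q.
have Lf i : L2 (leb2 R) (domain Q) (fn (u i)) by have [] := Hu i.
have Lg i j : L2 (leb2 R) (domain Q) (grad (u i) j) by have [_ + _ _] := Hu i; apply.
have Lt i h e : L2 (leb1 R) (side_range Q h) (trc (u i) \o side Q h e).
  by have [_ _ + _] := Hu i; apply.
have [v vP] := @choice _ _ (fun i (v : nat -> R * R -> R) => [/\ forall n, C1 (v n),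
        L2_cvg (leb2 R) (domain Q) v (fn (u i)),
        forall j, L2_cvg (leb2 R) (domain Q) (fun n => partial j (v n)) (grad (u i) j)
      & forall h e, L2_cvg (leb1 R) (side_range Q h)
          (fun n => v n \o side Q h e) (trc (u i) \o side Q h e)])
  (fun i => let: And4 _ _ _ t := Hu i in t).
have v1 i n : C1 (v i n) by have [] := vP i.
split.
- exact: L2_sum.
- by move=> j; apply: (L2_sum _ _ _ (Lg ^~ j)).
- by move=> h e; apply: (L2_sum _ _ _ (fun i => Lt i h e)); exact: measurable_side.
exists (fun n x => \sum_(i < k) c 0 i * v i n x).
have S n := C1_comb (index_enum 'I_k) (fun i => c 0 i) (fun i => v1 i n).
split.
- by move=> n; have [] := S n.
- apply: L2_cvg_sum => //.
  + by move=> i n; apply: L2_domain; exact: C1_cont.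
  + by move=> i; have [] := vP i.
- move=> j; rewrite (_ : (fun n => _) = (fun n x => \sum_(i < k) c 0 i * partial j (v i n) x)); last first.
    by apply/funext => n; have [_ ->] := S n.
  have A i n : L2 (leb2 R) (domain Q) (partial j (v i n)) by apply: L2_domain; exact: (v1 i n).2.
  have B i : L2_cvg (leb2 R) (domain Q) (fun n => partial j (v i n)) (grad (u i) j).
    by have [_ _ + _] := vP i; apply.
  by apply: (L2_cvg_sum _ _ _ A (Lg ^~ j) B).
- move=> h e.
  have A i n : L2 (leb1 R) (side_range Q h) (v i n \o side Q h e) by apply: L2_side; exact: C1_cont.
  have B i : L2_cvg (leb1 R) (side_range Q h) (fun n => v i n \o side Q h e) (trc (u i) \o side Q h e).
    by have [_ _ _ +] := vP i; apply.
  by apply: (L2_cvg_sum _ _ _ A (fun i => Lt i h e) B); exact: measurable_side.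
Qed.

Definition robin_form Q beta w : R :=
  \int[leb2 R]_(x in domain Q) (grad w false x ^+ 2 + grad w true x ^+ 2)
   + beta * boundary_integral Q (fun x => trc w x ^+ 2).

Definition mass Q w : R := \int[leb2 R]_(x in domain Q) (fn w x ^+ 2).

Lemma rayleighE Q beta w : rayleigh Q beta w = robin_form Q beta w / mass Q w.
Proof. by []. Qed.

(** Inequalities between the quadratic forms at hand thus extend from C^1 functions to
    [H1]. *)
Lemma approximable_limit Q beta w : approximable Q w ->
  exists v : nat -> R * R -> R, [/\ forall n, C1 (v n),
    (fun n => mass Q (c1data (v n))) @ \oo --> mass Q w,
    (fun n => robin_form Q beta (c1data (v n))) @ \oo --> robin_form Q beta w &
    forall g, continuous g ->
     (fun n => \int[leb2 R]_(x in domain Q) (v n x * g x)) @ \oo -->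
       \int[leb2 R]_(x in domain Q) (fn w x * g x)].
Proof.
move=> [Lf Lg Lt [v [v1 cv cg ct]]]; have mD := measurable_domain Q.
have Lv n : L2 (leb2 R) (domain Q) (v n) by apply: L2_domain; exact: C1_cont.
have Lp j n : L2 (leb2 R) (domain Q) (partial j (v n)) by apply: L2_domain; exact: (v1 n).2.
have Ls h e n : L2 (leb1 R) (side_range Q h) (v n \o side Q h e) by apply: L2_side; exact: C1_cont.
exists v; split => //.
- exact: L2_cvg_norm.
- rewrite /robin_form; apply: cvgD.
    rewrite RintegralD//; [|exact: L2_sqr (Lg false)|exact: L2_sqr (Lg true)].
    rewrite (_ : (fun n => _) = (fun n => \int[leb2 R]_(x in domain Q) (partial false (v n) x ^+ 2)
       + \int[leb2 R]_(x in domain Q) (partial true (v n) x ^+ 2))); last first.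
      by apply/funext => n; rewrite RintegralD//; [exact: L2_sqr (Lp false n)|exact: L2_sqr (Lp true n)].
    by apply: cvgD; [apply: L2_cvg_norm => //; exact: Lp|apply: L2_cvg_norm => //; exact: Lp].
  apply: cvgM; first exact: cvg_cst.
  have mS h : @measurable _ (measurableTypeR R) (side_range Q h) := measurable_side Q h.
  pose a h e n := \int[leb1 R]_(s in side_range Q h) (v n (side Q h e s) ^+ 2).
  pose l h e := \int[leb1 R]_(s in side_range Q h) (trc w (side Q h e s) ^+ 2).
  have S h e : a h e @ \oo --> l h e := L2_cvg_norm (mS h) (Ls h e) (Lt h e) (ct h e).
  have aE n : boundary_integral Q (fun x => trc (c1data (v n)) x ^+ 2) =
      (a true true n + a true false n) + (a false true n + a false false n).
    by rewrite /boundary_integral big_bool/= !big_bool.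
  have lE : boundary_integral Q (fun x => trc w x ^+ 2) =
      (l true true + l true false) + (l false true + l false false).
    by rewrite /boundary_integral big_bool/= !big_bool.
  rewrite lE (funext aE); clearbody a l.
  apply: (@cvgD _ _ _ _ _ (fun n => a true true n + a true false n)
    (fun n => a false true n + a false false n)).
    exact: (@cvgD _ _ _ _ _ (a true true) (a true false) _ _ (S _ _) (S _ _)).
  exact: (@cvgD _ _ _ _ _ (a false true) (a false false) _ _ (S _ _) (S _ _)).
- by move=> g cg'; apply: L2_cvg_dot => //; exact: L2_domain.
Qed.

End Sobolev.

(** * The first two eigenvalues of a rectangle *)

Section Tensor.
Context {R : realType}.
Implicit Types (Q : rectangle R) (beta lam : R) (f g : R * R -> R) (F G : R -> R).

(** In the coordinates of the unrotated rectangle, this is [F x * G y]. *)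
Definition tensor t F G (p : R * R) : R :=
  F (cos t * p.1 + sin t * p.2) * G (- sin t * p.1 + cos t * p.2).

Lemma tensor_rot t F G x y : tensor t F G (rot t (x, y)) = F x * G y.
Proof.
rewrite /tensor /rot /=; have e := cos2Dsin2 t; congr (F _ * G _).
  transitivity ((cos t ^+ 2 + sin t ^+ 2) * x); [ring|by rewrite e mul1r].
transitivity ((cos t ^+ 2 + sin t ^+ 2) * y); [ring|by rewrite e mul1r].
Qed.

Lemma is_diff_ridge F F' (u v : R) (p : R * R) : C1fun F F' ->
  is_diff p (fun p : R * R => F (u * p.1 + v * p.2))
    (fun h => F' (u * p.1 + v * p.2) * (u * h.1 + v * h.2)).
Proof.
move=> [dF _]; pose l (p : R * R) := u * p.1 + v * p.2.
have ll : linear l.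
  move=> k x y; rewrite /l /= /GRing.scale/=; ring.
pose lL := GRing.isLinear.Build R (R * R)%type R _ l ll.
pose L : {linear (R * R)%type -> R} := HB.pack l lL.
have cl : continuous l by rewrite /l; cont.
have dl : is_diff p l l.
  apply: DiffDef; first exact: (@linear_differentiable _ _ _ L).
  exact: (@diff_lin _ _ _ L).
have dFl : is_diff (l p) F (fun h => F' (l p) * h).
  have d := dF (l p).
  have dd : differentiable F (l p) by apply/derivable1_diffP/ex_derive.
  apply: DiffDef => //; apply/funext => h.
  rewrite deriv1E; last exact: ex_derive.
  by rewrite derive1E derive_val /GRing.scale/= mulrC.
exact: is_diff_comp.
Qed.

Lemma tensor_C1 t F F' G G' : C1fun F F' -> C1fun G G' -> C1 (tensor t F G).
Proof.
move=> F1 G1; have cF := C1fun_cont F1; have cG := C1fun_cont G1.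
have [_ cF'] := F1; have [_ cG'] := G1.
have D p := is_diffM (is_diff_ridge (cos t) (sin t) p F1) (is_diff_ridge (- sin t) (cos t) p G1).
have df p : differentiable (tensor t F G) p by have [] := D p.
split => // i.
rewrite (_ : partial i _ = (fun p => 'd (tensor t F G) p (dir i))); last first.
  by apply/funext => p; rewrite /partial deriveE.
rewrite (_ : (fun p => _) = (fun p : R * R =>
   F (cos t * p.1 + sin t * p.2) * (G' (- sin t * p.1 + cos t * p.2) *
     (- sin t * (dir i).1 + cos t * (dir i).2)) +
   G (- sin t * p.1 + cos t * p.2) * (F' (cos t * p.1 + sin t * p.2) *
     (cos t * (dir i).1 + sin t * (dir i).2)))); last first.
  by apply/funext => p; have [_ ->] := D p.
cont.
Qed.

(** In the unrotated coordinates the partial derivatives are [F' x * G y] and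
    [F x * G' y], and integrals of products over a box are products of integrals. *)
Lemma tensor_energy Q beta F F' G G' (t := rangle Q) :
  C1fun F F' -> C1fun G G' ->
  robin_form Q beta (c1data (tensor t F G)) =
   robin_energy beta (rleft Q) (rright Q) F F' * segint (rbottom Q) (rtop Q) (fun y => G y ^+ 2)
   + segint (rleft Q) (rright Q) (fun x => F x ^+ 2) * robin_energy beta (rbottom Q) (rtop Q) G G'.
Proof.
move=> F1 G1; have cF := C1fun_cont F1; have cG := C1fun_cont G1.
have [dF cF'] := F1; have [dG cG'] := G1.
have f1 := tensor_C1 t F1 G1; have C := C1_plane t f1.
rewrite /robin_form robin_form_plane//.
set V := fun p => tensor _ _ _ _ in C *; set Vx := fun p => cos _ * _ + _ in C *.
set Vy := fun p => - sin _ * _ + _ in C *.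
rewrite plane_energyE//.
have VE x y : V (x, y) = F x * G y by exact: tensor_rot.
have [_ _ _ dVx dVy] := C.
have VxE x y : Vx (x, y) = F' x * G y.
  have d1 := dVx x y; rewrite -(@derive_val _ _ _ _ _ _ _ d1).
  rewrite (_ : (fun s => _) = (fun s => F s * G y)); last by apply/funext => s; exact: VE.
  have d2 := dF x; rewrite derive_val /GRing.scale/=; ring.
have VyE x y : Vy (x, y) = F x * G' y.
  have d1 := dVy x y; rewrite -(@derive_val _ _ _ _ _ _ _ d1).
  rewrite (_ : (fun s => _) = (fun s => F x * G s)); last by apply/funext => s; exact: VE.
  have d2 := dG y; rewrite derive_val /GRing.scale/=; ring.
congr (_ + _).
  rewrite -segintZ; last cont.
  apply: eq_segint => y _; rewrite /robin_energy.
  rewrite (@eq_segint _ _ _ _ (fun x => G y ^+ 2 * F' x ^+ 2)); last by move=> x _; rewrite VxE; ring.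
  rewrite segintZ; last cont.
  by rewrite !VE; ring.
rewrite mulrC -segintZ; last cont.
apply: eq_segint => x _; rewrite /robin_energy.
rewrite (@eq_segint _ _ _ _ (fun y => F x ^+ 2 * G' y ^+ 2)); last by move=> y _; rewrite VyE; ring.
rewrite segintZ; last cont.
by rewrite !VE; ring.
Qed.

Lemma tensor_mass Q F F' G G' (t := rangle Q) : C1fun F F' -> C1fun G G' ->
  mass Q (c1data (tensor t F G)) =
   segint (rleft Q) (rright Q) (fun x => F x ^+ 2) * segint (rbottom Q) (rtop Q) (fun y => G y ^+ 2).
Proof.
move=> F1 G1; have cF := C1fun_cont F1; have cG := C1fun_cont G1.
have cf := C1_cont (tensor_C1 t F1 G1).
rewrite /mass /= segint_rot; last cont.
rewrite -segintZ; last cont.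
apply: eq_segint => y _; rewrite mulrC -segintZ; last cont.
by apply: eq_segint => x _; rewrite tensor_rot; ring.
Qed.

End Tensor.

Section Eigenvalues.
Context {R : realType}.
Implicit Types (Q : rectangle R) (beta lam t : R) (f g : R * R -> R) (F G phi psi : R -> R).

Lemma mass_eq0 Q w : L2 (leb2 R) (domain Q) (fn w) ->
  mass Q w = 0 <-> {ae leb2 R, forall x, domain Q x -> fn w x = 0}.
Proof. by move=> L; apply: L2_norm_eq0 => //; exact: measurable_domain. Qed.

Lemma mass_gt0 Q k (u : 'I_k -> h1data) (c : 'rV[R]_k) : H1_basis Q u -> c != 0 ->
  0 < mass Q (comb c u).
Proof.
move=> [Hu ind] c0; have [L _ _ _] := approximable_comb c (fun i => H1_approximable (Hu i)).
rewrite lt_neqAle; apply/andP; split; last by apply: Rintegral_ge0 => x _; exact: sqr_ge0.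
apply/eqP => m0; move/eqP: c0; apply; apply: ind.
by apply/(mass_eq0 L).
Qed.

(** Min-max principle: one space on which the Rayleigh quotient is at most [lam], and a
    function in each space on which it is at least [lam]. The positivity of the masses
    also makes the functions [f i] linearly independent. *)
Lemma robin_eigenvalueP Q beta k lam (f : 'I_k -> R * R -> R) :
  (forall i, C1 (f i)) ->
  (forall c : 'rV[R]_k, c != 0 ->
     0 < mass Q (comb c (fun i => c1data (f i))) /\
     robin_form Q beta (comb c (fun i => c1data (f i))) <=
       lam * mass Q (comb c (fun i => c1data (f i)))) ->
  (forall u : 'I_k -> h1data, H1_basis Q u ->
     exists2 c : 'rV[R]_k, c != 0 & lam * mass Q (comb c u) <= robin_form Q beta (comb c u)) ->
  robin_eigenvalue Q beta k = lam.
Proof.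
move=> f1 up low; rewrite /robin_eigenvalue.
suff -> : ereal_inf [set max_rayleigh Q beta u | u in @H1_basis R Q k] = lam%:E by [].
apply/eqP; rewrite eq_le; apply/andP; split.
  have B : H1_basis Q (fun i => c1data (f i)).
    split; first by move=> i; exact: C1_H1.
    move=> c ae; apply: contrapT => /eqP c0; have [+ _] := up c c0.
    have [_ cE] := comb_c1data c f1.
    have L : L2 (leb2 R) (domain Q) (fn (comb c (fun i => c1data (f i)))).
      rewrite cE; apply: L2_domain; apply: C1_cont.
      by have [] := comb_c1data c f1.
    by rewrite ((mass_eq0 L).2 ae) ltxx.
  apply: (@le_trans _ _ (max_rayleigh Q beta (fun i => c1data (f i)))).
    by apply: ereal_inf_lbound; exists (fun i => c1data (f i)).
  apply: ge_ereal_sup => _ [c /= c0 <-]; rewrite lee_fin rayleighE.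
  by have [m0 m1] := up c c0; rewrite ler_pdivrMr.
apply: le_ereal_inf_tmp => _ [u Hu <-].
have [c c0 cl] := low u Hu.
apply: (@le_trans _ _ (rayleigh Q beta (comb c u))%:E).
  by rewrite lee_fin rayleighE ler_pdivlMr// mass_gt0.
by apply: ereal_sup_ubound; exists c.
Qed.

Lemma massE Q f : continuous f -> mass Q (c1data f) =
  norm2 (rleft Q) (rright Q) (rbottom Q) (rtop Q) (fun p => f (rot (rangle Q) p)).
Proof. by move=> cf; rewrite /mass /norm2 /= segint_rot//; cont. Qed.

Lemma dot_tensorE Q f phi psi : continuous f -> continuous (tensor (rangle Q) phi psi) ->
  \int[leb2 R]_(x in domain Q) (f x * tensor (rangle Q) phi psi x) =
  segint (rbottom Q) (rtop Q) (fun y => segint (rleft Q) (rright Q)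
    (fun x => f (rot (rangle Q) (x, y)) * (phi x * psi y))).
Proof.
move=> cf cT; rewrite segint_rot; last cont.
by apply: eq_segint => y _; apply: eq_segint => x _; rewrite tensor_rot.
Qed.

Lemma robin_form_ge1 Q beta k1 k1' w : 0 < beta ->
  0 < k1 -> k1 * ((rright Q - rleft Q) / 2) + atan (k1 / beta) = pi / 2 ->
  0 < k1' -> k1' * ((rtop Q - rbottom Q) / 2) + atan (k1' / beta) = pi / 2 ->
  approximable Q w -> (k1 ^+ 2 + k1' ^+ 2) * mass Q w <= robin_form Q beta w.
Proof.
move=> b0 k0 kE k0' kE' /(approximable_limit beta)[v [v1 cm cf _]].
pose lhs n := (k1 ^+ 2 + k1' ^+ 2) * mass Q (c1data (v n)).
have cl : lhs @ \oo --> (k1 ^+ 2 + k1' ^+ 2) * mass Q w.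
  by apply: cvgM cm; exact: cvg_cst.
apply: (ler_cvg_to cl cf); apply: nearW => n; rewrite /robin_form robin_form_plane//.
have cv := C1_cont (v1 n).
have := plane_energy_ge1 b0 (rlr Q) (rbt Q) k0 kE k0' kE' (C1_plane (rangle Q) (v1 n)).
by rewrite /lhs massE.
Qed.

Lemma robin_form_ge2 Q beta k1 k1' k2 k2' delta (phi phi' psi psi' : R -> R) w :
  0 < beta -> 0 <= delta ->
  0 < k1 -> k1 <= k2 -> k2 * ((rright Q - rleft Q) / 2) + atan (k2 / beta) = pi ->
  delta <= k2 ^+ 2 - k1 ^+ 2 ->
  robin_mode beta (rleft Q) (rright Q) k1 phi phi' -> phi ((rleft Q + rright Q) / 2) != 0 ->
  segint (rleft Q) (rright Q) (fun x => phi x ^+ 2) = 1 ->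
  0 < k1' -> k1' <= k2' -> k2' * ((rtop Q - rbottom Q) / 2) + atan (k2' / beta) = pi ->
  delta <= k2' ^+ 2 - k1' ^+ 2 ->
  robin_mode beta (rbottom Q) (rtop Q) k1' psi psi' -> psi ((rbottom Q + rtop Q) / 2) != 0 ->
  segint (rbottom Q) (rtop Q) (fun x => psi x ^+ 2) = 1 ->
  approximable Q w ->
  (k1 ^+ 2 + k1' ^+ 2 + delta) * mass Q w
    - delta * (\int[leb2 R]_(x in domain Q) (fn w x * tensor (rangle Q) phi psi x)) ^+ 2
  <= robin_form Q beta w.
Proof.
move=> b0 d0 k0 k12 kE dk mp pm pN k0' k12' kE' dk' ms sm sN /(approximable_limit beta)[v [v1 cm cf cd]].
have p1 := robin_modeC1 mp; have s1 := robin_modeC1 ms.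
have cT := C1_cont (tensor_C1 (rangle Q) p1 s1).
have cr := cd _ cT.
pose lhs n := (k1 ^+ 2 + k1' ^+ 2 + delta) * mass Q (c1data (v n)) -
  delta * (\int[leb2 R]_(x in domain Q) (v n x * tensor (rangle Q) phi psi x)) ^+ 2.
have cl : lhs @ \oo --> (k1 ^+ 2 + k1' ^+ 2 + delta) * mass Q w -
  delta * (\int[leb2 R]_(x in domain Q) (fn w x * tensor (rangle Q) phi psi x)) ^+ 2.
  apply: cvgB; first by apply: cvgM cm; exact: cvg_cst.
  by apply: cvgM; [exact: cvg_cst|apply: cvgM; exact: cr].
apply: (ler_cvg_to cl cf).
apply: nearW => n; rewrite /robin_form robin_form_plane//.
have cv := C1_cont (v1 n).
have := plane_energy_ge2 b0 (rlr Q) (rbt Q) d0 k0 k12 kE dk mp pm pN k0' k12' kE' dk' ms sm sN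
  (C1_plane (rangle Q) (v1 n)).
by rewrite /lhs massE// dot_tensorE.
Qed.

Lemma tensor_suml (I : Type) (s : seq I) (c : I -> R) (F : I -> R -> R) t G :
  (fun p => \sum_(i <- s) c i * tensor t (F i) G p) =
  tensor t (fun x => \sum_(i <- s) c i * F i x) G.
Proof.
by apply/funext => p; rewrite /tensor mulr_suml; apply: eq_bigr => i _; rewrite mulrA.
Qed.

Lemma tensor_sumr (I : Type) (s : seq I) (c : I -> R) F t (G : I -> R -> R) :
  (fun p => \sum_(i <- s) c i * tensor t F (G i) p) =
  tensor t F (fun x => \sum_(i <- s) c i * G i x).
Proof.
by apply/funext => p; rewrite /tensor mulr_sumr; apply: eq_bigr => i _; rewrite mulrCA.
Qed.

Lemma mode_energy beta a b k phi phi' : a < b -> robin_mode beta a b k phi phi' ->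
  robin_energy beta a b phi phi' = k ^+ 2 * segint a b (fun x => phi x ^+ 2).
Proof.
move=> ab m; have := robin_mode_weak ab m (robin_modeC1 m).
have sqE (g : R -> R) : segint a b (fun x => g x * g x) = segint a b (fun x => g x ^+ 2).
  by apply: eq_segint => x _; rewrite expr2.
by rewrite !sqE -!expr2.
Qed.

(** Two modes are orthogonal for the scalar product, and by their weak equations also
    for the energy. *)
Lemma two_modes beta a b k1 k2 p p' q q' (c0 c1 : R) : a < b -> k1 ^+ 2 != k2 ^+ 2 ->
  robin_mode beta a b k1 p p' -> segint a b (fun x => p x ^+ 2) = 1 ->
  robin_mode beta a b k2 q q' -> segint a b (fun x => q x ^+ 2) = 1 ->
  [/\ C1fun (fun x => c0 * p x + c1 * q x) (fun x => c0 * p' x + c1 * q' x),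
      segint a b (fun x => (c0 * p x + c1 * q x) ^+ 2) = c0 ^+ 2 + c1 ^+ 2 &
      robin_energy beta a b (fun x => c0 * p x + c1 * q x) (fun x => c0 * p' x + c1 * q' x) =
        k1 ^+ 2 * c0 ^+ 2 + k2 ^+ 2 * c1 ^+ 2].
Proof.
move=> ab k12 mp Np mq Nq.
have orth := robin_mode_orth ab k12 mp mq.
have Z1 := robin_modeC1 mp; have Z2 := robin_modeC1 mq.
have C : C1fun (fun x => c0 * p x + c1 * q x) (fun x => c0 * p' x + c1 * q' x).
  split; last by apply: contD; [exact: (C1funZ c0 Z1).2|exact: (C1funZ c1 Z2).2].
  move=> x; have d1 := (C1funZ c0 Z1).1 x; have d2 := (C1funZ c1 Z2).1 x.
  exact: is_deriveD.
have cp := C1fun_cont Z1; have cq := C1fun_cont Z2; have [_ cp'] := Z1; have [_ cq'] := Z2.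
have e1 : segint a b (fun x => (c0 * p x + c1 * q x) * p x) = c0.
  rewrite (eq_segint (g := fun x => c0 * p x ^+ 2 + c1 * (q x * p x))); last by move=> x _; ring.
  rewrite segintD; [|cont|cont]; rewrite !segintZ; [|cont|cont].
  by rewrite Np orth mulr1 mulr0 addr0.
have e2 : segint a b (fun x => (c0 * p x + c1 * q x) * q x) = c1.
  rewrite (eq_segint (g := fun x => c0 * (q x * p x) + c1 * q x ^+ 2)); last by move=> x _; ring.
  rewrite segintD; [|cont|cont]; rewrite !segintZ; [|cont|cont].
  by rewrite Nq orth mulr1 mulr0 add0r.
split=> //.
  rewrite (eq_segint (g := fun x => c0 * ((c0 * p x + c1 * q x) * p x)
     + c1 * ((c0 * p x + c1 * q x) * q x))); last by move=> x _; ring.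
  rewrite segintD; [|cont|cont]; rewrite !segintZ; [|cont|cont].
  by rewrite e1 e2 !expr2.
have W1 := robin_mode_weak ab mp C; have W2 := robin_mode_weak ab mq C.
rewrite e1 in W1; rewrite e2 in W2.
rewrite /robin_energy.
rewrite (eq_segint (g := fun x => c0 * ((c0 * p' x + c1 * q' x) * p' x)
     + c1 * ((c0 * p' x + c1 * q' x) * q' x))); last by move=> x _; ring.
rewrite segintD; [|cont|cont]; rewrite !segintZ; [|cont|cont].
move: W1 W2; set I1 := segint _ _ _; set I2 := segint _ _ _ => W1 W2.
have -> : k1 ^+ 2 * c0 ^+ 2 + k2 ^+ 2 * c1 ^+ 2 = c0 * (k1 ^+ 2 * c0) + c1 * (k2 ^+ 2 * c1) by ring.
rewrite -W1 -W2; ring.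
Qed.

(** The product of the first modes of the two sides is a ground state. *)
Lemma robin_eigenvalue1 Q beta k1 k1' : 0 < beta ->
  0 < k1 -> k1 * ((rright Q - rleft Q) / 2) + atan (k1 / beta) = pi / 2 ->
  0 < k1' -> k1' * ((rtop Q - rbottom Q) / 2) + atan (k1' / beta) = pi / 2 ->
  robin_eigenvalue Q beta 1 = k1 ^+ 2 + k1' ^+ 2.
Proof.
move=> b0 k0 kE k0' kE'.
have [p [p' [mp _ Np]]] := robin_mode1_exists b0 (rlr Q) k0 kE.
have [q [q' [mq _ Nq]]] := robin_mode1_exists b0 (rbt Q) k0' kE'.
have f1 := tensor_C1 (rangle Q) (robin_modeC1 mp) (robin_modeC1 mq).
apply: (@robin_eigenvalueP Q beta 1 _ (fun=> tensor (rangle Q) p q)) => //.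
  move=> c c0; have [_ ->] := comb_c1data c (fun=> f1).
  have c00 : c 0 0 != 0.
    by apply: contra c0 => /eqP z; apply/eqP/rowP => i; rewrite ord1 mxE z.
  rewrite tensor_suml; have -> : (fun x => \sum_(i < 1) c 0 i * p x) = (fun x => c 0 0 * p x).
    by apply/funext => x; rewrite big_ord1.
  have mc := robin_modeZ (c 0 0) mp.
  rewrite (tensor_energy _ _ (robin_modeC1 mc) (robin_modeC1 mq)).
  rewrite (tensor_mass _ (robin_modeC1 mc) (robin_modeC1 mq)).
  rewrite (mode_energy (rlr Q) mc) (mode_energy (rbt Q) mq) Nq !mulr1; split.
    rewrite (eq_segint (g := fun x => c 0 0 ^+ 2 * p x ^+ 2)); last by move=> x _; ring.
    have cp := C1fun_cont (robin_modeC1 mp).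
    by rewrite segintZ ?Np ?mulr1 ?exprn_even_gt0//; cont.
  by rewrite mulrDl [X in _ + X <= _]mulrC.
move=> u [Hu ind]; exists (const_mx 1).
  by apply/eqP => /rowP/(_ 0)/eqP; rewrite !mxE oner_eq0.
apply: robin_form_ge1 => //; apply: approximable_comb => i; exact: H1_approximable.
Qed.

Lemma rV2_sqr_gt0 (c : 'rV[R]_2) : c != 0 -> 0 < c 0 0 ^+ 2 + c 0 1 ^+ 2.
Proof.
move=> c0; rewrite lt_neqAle addr_ge0 ?sqr_ge0// andbT eq_sym paddr_eq0 ?sqr_ge0//.
rewrite !sqrf_eq0; apply: contra c0 => /andP[/eqP h0 /eqP h1].
apply/eqP/rowP => i; rewrite mxE; case: (unliftP 0 i) => [j ->|->] //.
by rewrite ord1 (_ : lift 0 0 = 1)//; exact: val_inj.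
Qed.

Lemma dot_comb2 Q g (c : 'rV[R]_2) (u : 'I_2 -> h1data) : continuous g ->
  (forall i, H1 Q (u i)) ->
  \int[leb2 R]_(x in domain Q) (fn (comb c u) x * g x) =
  c 0 0 * \int[leb2 R]_(x in domain Q) (fn (u 0) x * g x)
   + c 0 1 * \int[leb2 R]_(x in domain Q) (fn (u 1) x * g x).
Proof.
move=> cg Hu; have mD := measurable_domain Q; have Lg := L2_domain Q cg.
have i0 : (leb2 R).-integrable (domain Q) (EFin \o (fun x => fn (u 0) x * g x)).
  by apply: L2_mul => //; have [] := Hu 0.
have i1 : (leb2 R).-integrable (domain Q) (EFin \o (fun x => fn (u 1) x * g x)).
  by apply: L2_mul => //; have [] := Hu 1.
rewrite -!RintegralZl// -RintegralD//; last 2 first.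
- by apply: (integrableZl _ (c 0 0) i0).
- by apply: (integrableZl _ (c 0 1) i1).
apply: eq_Rintegral => x _; rewrite /comb/= big_ord_recl big_ord1.
by rewrite (_ : lift ord0 ord0 = 1) ?mulrDl ?mulrA//; exact: val_inj.
Qed.

(** The minimum is reached on the products of the first mode of a side with the span of
    the first two modes of the other side, the one with the smaller gap. Conversely, a
    two-dimensional space contains a nonzero function orthogonal to the product of the
    two first modes, and [robin_form_ge2] applies to it. *)
Lemma robin_eigenvalue2 Q beta k1 k1' k2 k2' : 0 < beta ->
  0 < k1 -> k1 * ((rright Q - rleft Q) / 2) + atan (k1 / beta) = pi / 2 ->
  0 < k1' -> k1' * ((rtop Q - rbottom Q) / 2) + atan (k1' / beta) = pi / 2 ->
  k1 < k2 -> k2 * ((rright Q - rleft Q) / 2) + atan (k2 / beta) = pi ->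
  k1' < k2' -> k2' * ((rtop Q - rbottom Q) / 2) + atan (k2' / beta) = pi ->
  robin_eigenvalue Q beta 2 =
   k1 ^+ 2 + k1' ^+ 2 + Num.min (k2 ^+ 2 - k1 ^+ 2) (k2' ^+ 2 - k1' ^+ 2).
Proof.
move=> b0 k0 kE k0' kE' k12 k2E k12' k2E'.
have k20 := lt_trans k0 k12; have k20' := lt_trans k0' k12'.
have [p [p' [mp pm Np]]] := robin_mode1_exists b0 (rlr Q) k0 kE.
have [q [q' [mq qm Nq]]] := robin_mode1_exists b0 (rbt Q) k0' kE'.
have [r [r' [mr Nr]]] := robin_mode2_exists b0 (rlr Q) k20 k2E.
have [s [s' [ms Ns]]] := robin_mode2_exists b0 (rbt Q) k20' k2E'.
have p1 := robin_modeC1 mp; have q1 := robin_modeC1 mq.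
have r1 := robin_modeC1 mr; have s1 := robin_modeC1 ms.
have sq : k1 ^+ 2 < k2 ^+ 2 by rewrite ltr_sqrP.
have sq' : k1' ^+ 2 < k2' ^+ 2 by rewrite ltr_sqrP.
have low u : @H1_basis R Q 2 u -> exists2 c : 'rV[R]_2, c != 0 &
   (k1 ^+ 2 + k1' ^+ 2 + Num.min (k2 ^+ 2 - k1 ^+ 2) (k2' ^+ 2 - k1' ^+ 2)) * mass Q (comb c u)
     <= robin_form Q beta (comb c u).
  move=> [Hu ind]; have cT := C1_cont (tensor_C1 (rangle Q) p1 q1).
  pose d i := \int[leb2 R]_(x in domain Q) (fn (u i) x * tensor (rangle Q) p q x).
  have [c c0 cd] : exists2 c : 'rV[R]_2, c != 0 & c 0 0 * d 0 + c 0 1 * d 1 = 0.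
    have [d0|d0] := eqVneq (d 0) 0.
      exists (\row_(j < 2) (j == 0)%:R).
        by apply/eqP => /rowP/(_ 0)/eqP; rewrite !mxE eqxx oner_eq0.
      by rewrite !mxE d0 /= mulr0 mul0r addr0.
    exists (\row_(j < 2) (if j == 0 then - d 1 else d 0)).
      by apply/eqP => /rowP/(_ 1)/eqP; rewrite !mxE/= (negPf d0).
    by rewrite !mxE/=; ring.
  exists c => //.
  have H : approximable Q (comb c u) by apply: approximable_comb => i; exact: H1_approximable.
  have := robin_form_ge2 b0 _ k0 (ltW k12) k2E _ mp pm Np k0' (ltW k12') k2E' _ mq qm Nq H.
  move=> /(_ (Num.min (k2 ^+ 2 - k1 ^+ 2) (k2' ^+ 2 - k1' ^+ 2))).
  rewrite (dot_comb2 c cT Hu) -/(d 0) -/(d 1) cd expr0n/= mulr0 subr0.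
  by apply; rewrite ?ge_min ?lexx ?orbT// le_min !subr_ge0 !ltW.
have sum2 (c : 'rV[R]_2) (F : 'I_2 -> R -> R) (x : R) :
    \sum_(i < 2) c 0 i * F i x = c 0 0 * F 0 x + c 0 1 * F 1 x.
  by rewrite big_ord_recl big_ord1 (_ : lift ord0 ord0 = 1)//; exact: val_inj.
have [gap|gap] := leP (k2 ^+ 2 - k1 ^+ 2) (k2' ^+ 2 - k1' ^+ 2).
- rewrite (min_idPl gap) in low.
  pose F (i : 'I_2) := if i == 0 then p else r.
  pose F' (i : 'I_2) := if i == 0 then p' else r'.
  have F1 i : C1fun (F i) (F' i) by rewrite /F /F'; case: ifP.
  apply: (@robin_eigenvalueP Q beta 2 _ (fun i => tensor (rangle Q) (F i) q)) => //.
    by move=> i; exact: tensor_C1 (F1 i) q1.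
  move=> c c0; have [_ ->] := comb_c1data c (fun i => tensor_C1 (rangle Q) (F1 i) q1).
  rewrite tensor_suml.
  have -> : (fun x => \sum_(i < 2) c 0 i * F i x) = (fun x => c 0 0 * p x + c 0 1 * r x).
    by apply/funext => x; rewrite sum2.
  have [C N E] := two_modes (c 0 0) (c 0 1) (rlr Q) (negbT (lt_eqF sq)) mp Np mr Nr.
  rewrite (tensor_energy _ _ C q1) (tensor_mass _ C q1) (mode_energy (rbt Q) mq) Nq N E !mulr1.
  have cpos := rV2_sqr_gt0 c0; split=> //.
  have : 0 <= (k2 ^+ 2 - k1 ^+ 2) * c 0 0 ^+ 2 by rewrite mulr_ge0 ?sqr_ge0// subr_ge0 ltW.
  lra.
- rewrite (min_idPr (ltW gap)) in low.
  pose F (i : 'I_2) := if i == 0 then q else s.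
  pose F' (i : 'I_2) := if i == 0 then q' else s'.
  have F1 i : C1fun (F i) (F' i) by rewrite /F /F'; case: ifP.
  apply: (@robin_eigenvalueP Q beta 2 _ (fun i => tensor (rangle Q) p (F i))) => //.
    by move=> i; exact: tensor_C1 p1 (F1 i).
  move=> c c0; have [_ ->] := comb_c1data c (fun i => tensor_C1 (rangle Q) p1 (F1 i)).
  rewrite tensor_sumr.
  have -> : (fun x => \sum_(i < 2) c 0 i * F i x) = (fun x => c 0 0 * q x + c 0 1 * s x).
    by apply/funext => x; rewrite sum2.
  have [C N E] := two_modes (c 0 0) (c 0 1) (rbt Q) (negbT (lt_eqF sq')) mq Nq ms Ns.
  rewrite (tensor_energy _ _ p1 C) (tensor_mass _ p1 C) (mode_energy (rlr Q) mp) Np N E !mulr1 !mul1r.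
  have cpos := rV2_sqr_gt0 c0; split=> //.
  have : 0 <= (k2' ^+ 2 - k1' ^+ 2) * c 0 0 ^+ 2 by rewrite mulr_ge0 ?sqr_ge0// subr_ge0 ltW.
  lra.
Qed.

End Eigenvalues.

(** * The spectral ratio *)

Section Ratio.
Context {R : realType}.
Implicit Types (Q : rectangle R) (alpha beta : R).

Lemma freq_scale c beta l k : 0 < beta -> freq_eq c (beta * l / 2) k ->
  0 < beta * k /\ (beta * k) * (l / 2) + atan (beta * k / beta) = c.
Proof.
move=> b0 [k0 <-]; split; first exact: mulr_gt0.
by rewrite [beta * k]mulrC mulfK ?gt_eqF// -!mulrA.
Qed.

Lemma pihalf_lt_pi : pi / 2 < pi :> R.
Proof. by have := @pi_gt0 R; lra. Qed.

Lemma perimeter_gt0 Q : 0 < perimeter Q.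
Proof.
by rewrite mulr_gt0// addr_gt0// subr_gt0; [exact: rlr|exact: rbt].
Qed.

(** In units of length [1 / beta] the Robin parameter becomes 1, and the common factor
    [beta ^+ 2] of the eigenvalues disappears from their ratio. *)
Lemma spectral_ratioE alpha Q p q p' q' (beta := alpha / perimeter Q) : 0 < alpha ->
  freq_eq (pi / 2) (beta * rwidth Q / 2) p -> freq_eq pi (beta * rwidth Q / 2) q ->
  freq_eq (pi / 2) (beta * rheight Q / 2) p' -> freq_eq pi (beta * rheight Q / 2) q' ->
  spectral_ratio alpha Q =
    1 + Num.min (q ^+ 2 - p ^+ 2) (q' ^+ 2 - p' ^+ 2) / (p ^+ 2 + p' ^+ 2).
Proof.
move=> a0 hp hq hp' hq'.
have b0 : 0 < beta by rewrite divr_gt0// perimeter_gt0.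
have w0 : 0 < beta * rwidth Q / 2 by rewrite divr_gt0// mulr_gt0// subr_gt0 rlr.
have h0 : 0 < beta * rheight Q / 2 by rewrite divr_gt0// mulr_gt0// subr_gt0 rbt.
have pq := freq_lt w0 hp hq pihalf_lt_pi; have pq' := freq_lt h0 hp' hq' pihalf_lt_pi.
have [p0 _] := hp; have [p'0 _] := hp'.
have [k0 kE] := freq_scale b0 hp; have [k0' kE'] := freq_scale b0 hp'.
have [_ k2E] := freq_scale b0 hq; have [_ k2E'] := freq_scale b0 hq'.
rewrite /spectral_ratio -/beta (robin_eigenvalue1 b0 k0 kE k0' kE').
rewrite (robin_eigenvalue2 b0 k0 kE k0' kE' _ k2E _ k2E') ?ltr_pM2l//.
rewrite ger0_norm ?addr_ge0 ?sqr_ge0//; clearbody beta.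
rewrite !exprMn -!mulrBr -mulrDr -minr_pMr ?sqr_ge0//.
have S0 : 0 < p ^+ 2 + p' ^+ 2 by rewrite addr_gt0// exprn_gt0.
by field; rewrite !gt_eqF.
Qed.

(** This is where the length scaling enters: the rescaled half-lengths of the two sides
    have the same sum for all rectangles. *)
Lemma half_sum alpha Q :
  alpha / perimeter Q * rwidth Q / 2 + alpha / perimeter Q * rheight Q / 2 = 2 * (alpha / 8).
Proof.
have := perimeter_gt0 Q; rewrite /perimeter => L0.
have wh : rwidth Q + rheight Q != 0 by move: L0; rewrite pmulr_rgt0// => /lt0r_neq0.
by field.
Qed.

Lemma spectral_ratio_square alpha Q p q : 0 < alpha -> is_square Q ->
  freq_eq (pi / 2) (alpha / 8) p -> freq_eq pi (alpha / 8) q ->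
  spectral_ratio alpha Q = 1 + (q ^+ 2 - p ^+ 2) / (2 * p ^+ 2).
Proof.
move=> a0 sq hp hq; have := half_sum alpha Q; have E := sq; rewrite /is_square in E.
rewrite E => hE.
have e : alpha / perimeter Q * rheight Q / 2 = alpha / 8 by lra.
have e' : alpha / perimeter Q * rwidth Q / 2 = alpha / 8 by rewrite E.
rewrite (@spectral_ratioE alpha Q p q p q) ?e ?e'// minxx; congr (1 + _ / _); ring.
Qed.

(** The rescaled half-length of the longer side exceeds [alpha / 8], so that its gap is
    smaller than that of the square, while by convexity the first eigenvalue is at least
    that of the square. *)
Lemma spectral_ratio_nonsquare alpha Q p q : 0 < alpha -> ~ is_square Q ->
  freq_eq (pi / 2) (alpha / 8) p -> freq_eq pi (alpha / 8) q ->
  spectral_ratio alpha Q < 1 + (q ^+ 2 - p ^+ 2) / (2 * p ^+ 2).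
Proof.
move=> a0 nsq hp hq; pose beta := alpha / perimeter Q.
have b0 : 0 < beta by rewrite divr_gt0// perimeter_gt0.
have w0 : 0 < beta * rwidth Q / 2 by rewrite divr_gt0// mulr_gt0// subr_gt0 rlr.
have h0 : 0 < beta * rheight Q / 2 by rewrite divr_gt0// mulr_gt0// subr_gt0 rbt.
have hs := half_sum alpha Q; rewrite -/beta in hs.
have pih : 0 < pi / 2 :> R by rewrite divr_gt0// pi_gt0.
have [p1 hp1] := freq_exists pih w0; have [q1 hq1] := freq_exists (@pi_gt0 R) w0.
have [p2 hp2] := freq_exists pih h0; have [q2 hq2] := freq_exists (@pi_gt0 R) h0.
rewrite (spectral_ratioE a0 hp1 hq1 hp2 hq2).
have s0 : 0 < alpha / 8 by rewrite divr_gt0.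
have cv := freq1_convex w0 h0 hs hp1 hp2 hp.
have pq := freq_lt s0 hp hq pihalf_lt_pi.
have [p0 _] := hp; have [p10 _] := hp1; have [p20 _] := hp2.
have gap : Num.min (q1 ^+ 2 - p1 ^+ 2) (q2 ^+ 2 - p2 ^+ 2) < q ^+ 2 - p ^+ 2.
  have ne : beta * rwidth Q / 2 != beta * rheight Q / 2.
    apply/eqP => e; apply: nsq; rewrite /is_square.
    have b2 : beta / 2 != 0 by rewrite gt_eqF// divr_gt0.
    by apply: (mulfI b2); rewrite mulrAC e mulrAC.
  rewrite gt_min; apply/orP.
  have [wh|hw|e] := ltgtP (beta * rwidth Q / 2) (beta * rheight Q / 2); last by rewrite e eqxx in ne.
    by right; apply: (gap_decreasing s0 _ hp hq hp2 hq2); lra.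
  by left; apply: (gap_decreasing s0 _ hp hq hp1 hq1); lra.
have g0 : 0 < q ^+ 2 - p ^+ 2 by rewrite subr_gt0 ltr_sqrP// (lt_trans p0).
rewrite ltrD2l; apply: (@lt_le_trans _ _ ((q ^+ 2 - p ^+ 2) / (p1 ^+ 2 + p2 ^+ 2))).
  by rewrite ltr_pM2r// invr_gt0 addr_gt0// exprn_gt0.
by rewrite ler_pM2l// lef_pV2 ?posrE ?addr_gt0 ?mulr_gt0 ?exprn_gt0.
Qed.

End Ratio.

Theorem corollary3p11 (R : realType) (alpha : R) (halpha : 0 < alpha)
    (Q : rectangle R) :
  (forall Q' : rectangle R, spectral_ratio alpha Q' <= spectral_ratio alpha Q)
  <-> is_square Q.
Proof.
have s0 : 0 < alpha / 8 by rewrite divr_gt0.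
have pih : 0 < pi / 2 :> R by rewrite divr_gt0// pi_gt0.
have [p hp] := freq_exists pih s0; have [q hq] := freq_exists (@pi_gt0 R) s0.
split=> [Qmax|sq Q'].
  apply: contrapT => nsq.
  pose U := @Rectangle R 0 0 1 0 1 ltr01 ltr01.
  have := Qmax U; rewrite (spectral_ratio_square halpha (erefl : is_square U) hp hq).
  by rewrite leNgt spectral_ratio_nonsquare.
rewrite (spectral_ratio_square halpha sq hp hq).
have [sq'|nsq'] := pselect (is_square Q').
  by rewrite (spectral_ratio_square halpha sq' hp hq).
exact: ltW (spectral_ratio_nonsquare halpha nsq' hp hq).
Qed.
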